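(* Assume $\rho_0\in\mathcal{P}(\mathbb{R})$ and $v_0:\mathbb{R}\to\mathbb{R}$ is continuous with $\int_{\mathbb{R}}v_0^2\,d\rho_0<\infty$. Then there is a weak solution pair $\rho$ and $v$ of the sticky particle system which satisfies $\rho|_{t=0}=\rho_0$ and $v|_{t=0}=v_0$, $$(v(x,t)-v(y,t))(x-y)\le\frac{1}{t}(x-y)^2$$ for almost every $t>0$ and $\rho_t$-almost every $x,y\in\mathbb{R}$, and $$\int_{\mathbb{R}}\frac12 v(x,t)^2\,d\rho_t(x)\le\int_{\mathbb{R}}\frac12 v(x,s)^2\,d\rho_s(x)<\infty$$ for almost every $0\le s\le t<\infty$.
   Context: $\mathcal{P}(\mathbb{R})$ is the set of Borel probability measures on $\mathbb{R}$; $\sigma_k\to\sigma$ narrowly in $\mathcal{P}(\mathbb{R})$ if $\int g\,d\sigma_k\to\int g\,d\sigma$ for every bounded continuous $g:\mathbb{R}\to\mathbb{R}$. The sticky particle system is $\partial_t\rho+\partial_x(\rho v)=0$, $\partial_t(\rho v)+\partial_x(\rho v^2)=0$ in $\mathbb{R}\times(0,\infty)$. Weak solution pair: given $\rho_0\in\mathcal{P}(\mathbb{R})$ and continuous $v_0:\mathbb{R}\to\mathbb{R}$, a narrowly continuous $\rho:(0,\infty)\to\mathcal{P}(\mathbb{R})$, $t\mapsto\rho_t$, and a Borel measurable $v:\mathbb{R}\times(0,\infty)\to\mathbb{R}$ form a weak solution pair of the sticky particle system with initial conditions $\rho|_{t=0}=\rho_0$ and $v|_{t=0}=v_0$ provided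 $$\int_0^\infty\int_{\mathbb{R}}(\partial_t\psi+v\,\partial_x\psi)\,d\rho_t\,dt+\int_{\mathbb{R}}\psi(\cdot,0)\,d\rho_0=0$$ and $$\int_0^\infty\int_{\mathbb{R}}(v\,\partial_t\psi+v^2\,\partial_x\psi)\,d\rho_t\,dt+\int_{\mathbb{R}}\psi(\cdot,0)v_0\,d\rho_0=0$$ for each $\psi\in C_c^\infty(\mathbb{R}\times[0,\infty))$. ''Almost every'' for times refers to Lebesgue measure; ''for almost every $0\le s\le t<\infty$'' means that there is a Lebesgue-null set $N\subset[0,\infty)$ such that the assertion holds for all $s\le t$ outside $N$ (one may take $0\in N$). ''For $\rho_t$-almost every $x,y$'' means for all $x,y$ in some Borel set of full $\rho_t$-measure. *)

(* Defs.v *)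
From HB Require Import structures.
From mathcomp Require Import all_boot all_order all_algebra.
From mathcomp Require Import all_classical all_reals all_analysis.

Set Implicit Arguments.
Unset Strict Implicit.
Unset Printing Implicit Defensive.

Import Order.TTheory GRing.Theory Num.Theory.
Import numFieldNormedType.Exports.

Local Open Scope classical_set_scope.
Local Open Scope ring_scope.

(* A point of the (x, t)-plane is a pair p with p.1 = x and p.2 = t. *)

Definition partial_x (R : realType) (psi : R * R -> R) (p : R * R) : R :=
  derive1 (fun x : R => psi (x, p.2)) p.1.

Definition partial_t (R : realType) (psi : R * R -> R) (p : R * R) : R :=
  derive1 (fun t : R => psi (p.1, t)) p.2.

Fixpoint Ck (R : realType) (k : nat) (psi : R * R -> R) : Prop :=
  match k with
  | 0%N => continuous psi
  | k'.+1 =>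
    [/\ continuous psi,
        forall p, derivable (fun x : R => psi (x, p.2)) p.1 1,
        forall p, derivable (fun t : R => psi (p.1, t)) p.2 1,
        Ck k' (partial_x psi) &
        Ck k' (partial_t psi)]
  end.

Definition smooth (R : realType) (psi : R * R -> R) : Prop :=
  forall k, Ck k psi.

(* An element of C_c^oo(R x [0, +oo[) is represented by a smooth function on
   the whole plane whose restriction to R x [0, +oo[ has compact support; its
   values for t < 0 play no role.  It need not vanish at t = 0. *)
Definition test_function (R : realType) (psi : R * R -> R) : Prop :=
  smooth psi /\
  compact (closure [set p : R * R | 0 <= p.2 /\ psi p != 0]).

Definition narrow_cvg (R : realType) (T : Type) (F : set_system T)
    (sigma : T -> probability (measurableTypeR R) R)
    (l : probability (measurableTypeR R) R) : Prop :=
  forall g : R -> R, continuous g -> bounded_fun g ->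
    (\int[sigma k]_x g x @[k --> F]) --> \int[l]_x g x.

(* rho is a total function of time, but only its values at t > 0 matter, here
   and everywhere below; likewise for v (x, t). *)
Definition narrowly_continuous (R : realType)
    (rho : R -> probability (measurableTypeR R) R) : Prop :=
  forall t : R, 0 < t -> narrow_cvg (nbhs t) rho (rho t).

(* f is absolutely integrable for the measure d rho_t dt on R x ]0, +oo[. *)
Definition spacetime_integrable (R : realType)
    (rho : R -> probability (measurableTypeR R) R) (f : R * R -> R) : Prop :=
  (\int[@lebesgue_measure R]_(t in `]0%R, +oo[)
     \int[rho t]_x `|f (x, t)|%:E < +oo)%E.

Definition spacetime_integral (R : realType)
    (rho : R -> probability (measurableTypeR R) R) (f : R * R -> R) : \bar R :=
  (\int[@lebesgue_measure R]_(t in `]0%R, +oo[) \int[rho t]_x (f (x, t))%:E)%E.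

(* The integrability clauses make explicit that the integrals in the weak
   formulation exist: the library's integral is total, and would otherwise
   return a conventional value. *)
Definition weak_solution_pair (R : realType)
    (rho0 : probability (measurableTypeR R) R) (v0 : R -> R)
    (rho : R -> probability (measurableTypeR R) R)
    (v : measurableTypeR R * measurableTypeR R -> R) : Prop :=
  [/\ narrowly_continuous rho,
      measurable_fun
        [set p : measurableTypeR R * measurableTypeR R | (0 : R) < p.2] v &
      forall psi : R * R -> R, test_function psi ->
        let mass p := partial_t psi p + v p * partial_x psi p in
        let momentum p := v p * partial_t psi p + v p ^+ 2 * partial_x psi p in
        [/\ spacetime_integrable rho mass,
            spacetime_integrable rho momentum,
            (spacetime_integral rho mass
               + \int[rho0]_x (psi (x, 0%R))%:E = 0)%E &
            (spacetime_integral rho momentum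
               + \int[rho0]_x (psi (x, 0%R) * v0 x)%:E = 0)%E]].

Definition kinetic_energy (R : realType)
    (rho : R -> probability (measurableTypeR R) R) (v : R * R -> R) (t : R) :
    \bar R :=
  (\int[rho t]_x (2^-1 * v (x, t) ^+ 2)%:E)%E.

(* Main.v *)
Require Import Defs.
From HB Require Import structures.
From mathcomp Require Import all_boot all_order all_algebra.
From mathcomp Require Import all_classical all_reals all_analysis.
From mathcomp Require Import measurable_realfun.
From mathcomp Require Import ring lra.

(** Particles are labelled by their mass coordinate m in ]0, 1[.  If q is the
    quantile function of rho0, particle m starts at q m with velocity
    c m = v0 (q m).  Let U be a convex primitive of q and V a primitive of c.
    Without interaction, particle m would sit at time t at q m + t c m, the
    slope of U + t V at m; this slope need not be monotone in m, which means
    that particles have crossed.  The sticky flow replaces U + t V by its convex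
    hull: position t m is the left slope of the hull at m.  Then rho_t is the
    image of the Lebesgue measure of ]0, 1[ under position t, and the particles
    glued at x are those of the interval ]alpha t x, beta t x[ on which the hull
    is affine with slope x.  Their common velocity is the mean of c over this
    interval, (V beta - V alpha) / (beta - alpha).

    Everything about the flow comes from comparing minimizers.  If k minimizes
    U + t V - x id and l minimizes U + s V - y id, then adding the two
    minimality inequalities gives (t - s) (V k - V l) <= (x - y) (k - l)
    (contact_compare).  For s = 0 this is the one-sided Lipschitz bound on the
    velocity (vel_entropy); for the end points of the block of m at two times it
    shows that m moves with the velocity of its block (position_right_deriv).
    Moreover (1 - s / t) U + (s / t) (U + t V) = U + s V with U convex, so
    glued particles remain glued (position_stick).

    The trajectory of a particle m is Lipschitz in time and, if q is continuous
    at m, has at all positive times but one the right derivative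
    vel t (position t m).  The fundamental theorem of calculus, obtained from
    dominated convergence of difference quotients (lipschitz_right_ftc), turns
    this into
      int_0^oo d/dt psi (position t m, t) dt = - psi (q m, 0)
    for almost every m (along_integral).  Integrating over m against 1 and
    against c m, and exchanging the integrals (weak_weighted), gives the two
    conservation laws, except that the second one carries c m instead of the
    velocity at time t.  The replacement is allowed since the velocity at time t
    is the conditional expectation of c given the position at time t
    (conditional_expectation), and the other factor depends on m through that
    position only.

    The energy decreases for the same reason: by stickiness the velocity at time
    t depends only on the position at an earlier time s, so
    int v_t^2 = int c v_t = int v_s v_t <= (int v_s^2 + int v_t^2) / 2. *)

Set Implicit Arguments.
Unset Strict Implicit.
Unset Printing Implicit Defensive.

Import Order.TTheory GRing.Theory Num.Theory.
Import numFieldNormedType.Exports.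

Local Open Scope classical_set_scope.
Local Open Scope ring_scope.

(** * Sticky positions as slopes of a convex hull *)

(** The initial data in the mass coordinate: initial positions, initial
    velocities, and their primitives pot and mom.  Only subgradients are asked
    of the convex function pot, as its limits at 0 and 1 may be
    infinite. *)
Record flow_data (R : realType) := FlowData {
  initpos : R -> R;
  initvel : R -> R;
  pot : R -> R;
  mom : R -> R;
  mom_max : R;
  initpos_nd : forall a b : R, 0 < a -> a <= b -> b < 1 ->
    initpos a <= initpos b;
  pot_sub : forall k m : R, 0 < k < 1 -> 0 < m < 1 ->
    pot k + initpos k * (m - k) <= pot m;
  mom_bnd : forall m : R, `|mom m| <= mom_max;
  mom_uc : forall e : R, 0 < e -> exists2 d : R, 0 < d &
    forall a b : R, 0 <= a <= 1 -> 0 <= b <= 1 -> `|a - b| < d ->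
      `|mom a - mom b| < e;
  mom_lip : forall m : R, 0 < m < 1 -> exists2 K : R, 0 <= K &
    forall a b : R, 0 < a < m -> m <= b < 1 -> `|mom b - mom a| <= K * (b - a);
  mom_diff : forall m : R, 0 < m < 1 -> {for m, continuous initpos} ->
    forall e : R, 0 < e -> exists2 d : R, 0 < d &
    forall b : R, `|b - m| < d ->
      `|mom b - mom m - initvel m * (b - m)| <= e * `|b - m|
}.

Section Hull.
Variables (R : realType) (p : flow_data R).
Local Notation q := (initpos p).
Local Notation U := (pot p).
Local Notation V := (mom p).
Local Notation B := (mom_max p).
Local Notation q_nd := (@initpos_nd R p).
Local Notation U_sub := (@pot_sub R p _ _).
Local Notation V_bnd := (@mom_bnd R p).
Local Notation V_uc := (@mom_uc R p _).

Definition tilted t x m : R := U m + t * V m - x * m.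
Local Notation J := tilted.

(** The left slope at m of the convex hull of pot + t mom is at most x.  In
    terms of the tilted function this says that no point on the left of m goes
    below all the points on its right; the margin e replaces a minimum over
    [m, 1[, which need not be attained. *)
Definition le_hull t m x := forall e a : R, 0 < e -> 0 < a < m ->
  exists2 b : R, m <= b < 1 & J t x b <= J t x a + e.

Definition position t m : R := inf [set x | le_hull t m x].
Local Notation X := position.

(** A function with locally bounded subgradients is continuous. *)
Lemma pot_loc m : 0 < m < 1 -> forall e : R, 0 < e ->
  exists2 d : R, 0 < d & forall b : R, `|b - m| < d ->
    0 < b < 1 /\ `|U b - U m| < e.
Proof.
move=> m01 e e0.
pose K : R := `|q (m / 2)| + `|q ((m + 1) / 2)| + 1.
have K0 : 0 < K by rewrite /K; have := normr_ge0 (q (m/2)); have := normr_ge0 (q ((m+1)/2)); lra.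
exists (Num.min (e / K) (Num.min (m / 2) ((1 - m) / 2))).
  by rewrite !lt_min divr_gt0//=; lra.
move=> b; rewrite !lt_min ltr_distl => /andP[bK /andP[bm bm']].
have [hb1 hb2] : (m / 2 < b /\ b < (m + 1) / 2) by move: bm bm'; rewrite !ltr_distl; lra.
have b01 : 0 < b < 1 by lra.
split=> //.
have qb1 : q (m / 2) <= q b by apply: q_nd; lra.
have qb2 : q b <= q ((m+1) / 2) by apply: q_nd; lra.
have qm1 : q (m / 2) <= q m by apply: q_nd; lra.
have qm2 : q m <= q ((m+1) / 2) by apply: q_nd; lra.
have Kb : `|q b| < K.
  rewrite /K ltr_norml; have := ler_norm (q ((m+1)/2)); have := ler_norm (- q (m/2)).
  by rewrite normrN; have := normr_ge0 (q (m/2)); have := normr_ge0 (q ((m+1)/2)); lra.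
have Km : `|q m| < K.
  rewrite /K ltr_norml; have := ler_norm (q ((m+1)/2)); have := ler_norm (- q (m/2)).
  by rewrite normrN; have := normr_ge0 (q (m/2)); have := normr_ge0 (q ((m+1)/2)); lra.
have h1 := U_sub m01 b01; have h2 := U_sub b01 m01.
have h3 : `|q m * (b - m)| <= K * `|b - m| by rewrite normrM ler_wpM2r// ltW.
have h4 : `|q b * (b - m)| <= K * `|b - m| by rewrite normrM ler_wpM2r// ltW.
have h5 : K * `|b - m| < e.
  have : `|b - m| < e / K by rewrite ltr_distl.
  by rewrite ltr_pdivlMr// mulrC.
move: h3 h4; rewrite !ler_norml => h3 h4; rewrite ltr_norml.
have : q b * (m - b) = - (q b * (b - m)) by ring.
lra.
Qed.

Lemma tilted_loc t x m : 0 < m < 1 -> forall e : R, 0 < e ->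
  exists2 d : R, 0 < d & forall b : R, `|b - m| < d ->
    0 < b < 1 /\ `|J t x b - J t x m| < e.
Proof.
move=> m01 e e0.
have e1 : 0 < e / 3 by lra.
have t1 : 0 < `|t| + 1 by have := normr_ge0 t; lra.
have x1 : 0 < `|x| + 1 by have := normr_ge0 x; lra.
have [d1 d10 h1] := pot_loc m01 e1.
have [d2 d20 h2] := V_uc (divr_gt0 e1 t1).
exists (Num.min d1 (Num.min d2 (e / 3 / (`|x| + 1)))).
  by rewrite !lt_min d10 d20 divr_gt0.
move=> b; rewrite !lt_min => /andP[bd1 /andP[bd2 bd3]].
have [b01 Ub] := h1 _ bd1; split => //.
have Vb : `|V b - V m| < e / 3 / (`|t| + 1) by apply: h2 => //; lra.
have hV : `|t * (V b - V m)| < e / 3.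
  rewrite normrM; move: Vb; rewrite ltr_pdivlMr// mulrC; apply: le_lt_trans.
  by rewrite ler_wpM2r//; lra.
have hx : `|x * (b - m)| < e / 3.
  rewrite normrM; move: bd3; rewrite ltr_pdivlMr// mulrC; apply: le_lt_trans.
  by rewrite ler_wpM2r//; lra.
have -> : J t x b - J t x m = (U b - U m) + t * (V b - V m) - x * (b - m).
  by rewrite /J; ring.
move: Ub hV hx; rewrite !ltr_norml; lra.
Qed.

Lemma pot_lb : exists C : R, forall m : R, 0 < m < 1 -> - C <= U m.
Proof.
exists (`|q (1/2)| - U (1/2)) => m m01.
have h01 : 0 < (1/2 : R) < 1 by lra.
have := U_sub h01 m01.
suff : - `|q (1/2)| <= q (1/2) * (m - 1/2) by lra.
have : `|q (1/2) * (m - 1/2)| <= `|q (1/2)|.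
  by rewrite normrM ler_piMr// ler_norml; lra.
by rewrite ler_norml; lra.
Qed.

Lemma mom_diff_bnd t a b : `|t * (V a - V b)| <= 2 * `|t| * B.
Proof.
rewrite normrM mulrAC mulrC ler_wpM2r//.
by apply: le_trans (ler_normB _ _) _; have := V_bnd a; have := V_bnd b; lra.
Qed.

Lemma tilted_lb t x : exists C : R, forall m : R, 0 < m < 1 -> - C <= J t x m.
Proof.
have [C hC] := pot_lb.
exists (C + `|t| * B + `|x|) => m m01.
have h1 : `|t * V m| <= `|t| * B by rewrite normrM ler_wpM2l ?V_bnd.
have h2 : `|x * m| <= `|x| by rewrite normrM ler_piMr// ler_norml; lra.
move: h1 h2; rewrite !ler_norml /J; have := hC _ m01; lra.
Qed.

Lemma tilted_near_inf t x e : 0 < e -> exists2 m1 : R, 0 < m1 < 1 &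
  forall m : R, 0 < m < 1 -> J t x m1 <= J t x m + e.
Proof.
move=> e0; have [C hC] := tilted_lb t x.
pose S := [set J t x m | m in [set m | 0 < m < 1]].
have hS : has_inf S.
  split; last by exists (- C) => _ [m m01 <-]; exact: hC.
  by exists (J t x (1/2)); exists (1/2) => //=; lra.
have [_ [m1 m101 <-] hm1] := inf_adherent e0 hS.
exists m1 => // m m01; apply/ltW/(lt_le_trans hm1); rewrite lerD2r.
by apply: ge_inf; [exact: hS.2|exists m].
Qed.

Lemma le_hull_mono t m x y : 0 < m < 1 -> x <= y -> le_hull t m x -> le_hull t m y.
Proof.
move=> m01 xy h e a e0 am; have [b bm Jb] := h e a e0 am; exists b => //.
have : 0 <= (y - x) * (b - a) by apply: mulr_ge0; lra.
move: Jb; rewrite /J; lra.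
Qed.

Lemma le_hull_anti t m n x : m <= n -> le_hull t n x -> le_hull t m x.
Proof.
move=> mn h e a e0 am; have [|b bm Jb] := h e a e0; first by lra.
by exists b => //; lra.
Qed.

Lemma le_hull_closed t m x : 0 < m < 1 -> (forall y, x < y -> le_hull t m y) ->
  le_hull t m x.
Proof.
move=> m01 h e a e0 am.
have e1 : 0 < e / 2 by lra.
have [|b bm Jb] := h (x + e / 2) _ (e / 2) a e1 am; first by lra.
exists b => //.
have : 0 <= e / 2 * (1 - (b - a)) by apply: mulr_ge0; lra.
move: Jb; rewrite /J; lra.
Qed.

Lemma le_hull_left t m x : 0 < m < 1 -> (forall n, 0 < n < m -> le_hull t n x) ->
  le_hull t m x.
Proof.
move=> m01 h e a e0 am.
have e1 : 0 < e / 2 by lra.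
have [d d0 hd] := tilted_loc t x m01 e1.
pose n := Num.max ((a + m) / 2) (m - d / 2).
have n1 : (a + m) / 2 <= n by rewrite le_max lexx.
have n2 : m - d / 2 <= n by rewrite le_max lexx orbT.
have n3 : n < m by rewrite gt_max; lra.
have [|//||b bm Jb] := h n _ (e / 2) a; [lra|lra|].
have [mb|bm'] := leP m b; first by exists b; lra.
exists m; first by lra.
have [|_ ] := hd b; first by rewrite ltr_norml; lra.
by rewrite ltr_norml; lra.
Qed.

Lemma le_hull_ex t m : 0 < m < 1 -> exists x, le_hull t m x.
Proof.
move=> m01; have [C hC] := pot_lb.
pose b := (m + 1) / 2; pose D := `|U b + C + 2 * `|t| * B|.
exists (D / (b - m)) => e a e0 am.
exists b; first by rewrite /b; lra.
have bm : 0 < b - m by rewrite /b; lra.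
have h1 := mom_diff_bnd t b a.
have h2 : D <= D / (b - m) * (b - a).
  by rewrite mulrAC ler_pdivlMr// ler_wpM2l ?normr_ge0//; lra.
have h3 : U b + C + 2 * `|t| * B <= D by exact: ler_norm.
have h4 := hC a ltac:(lra).
by move: h1; rewrite ler_norml /J; lra.
Qed.

Lemma le_hull_lb t m : 0 < m < 1 -> exists x0, forall x, le_hull t m x -> x0 <= x.
Proof.
move=> m01; have [C hC] := pot_lb.
pose a := m / 2; pose D := `|U a + C + 2 * `|t| * B + 1|.
have am : 0 < m - a by rewrite /a; lra.
exists (- D / (m - a)) => x h.
rewrite leNgt; apply/negP => xD.
have [||b bm Jb] := h 1 a; [by []|by rewrite /a; lra|].
have h1 := mom_diff_bnd t b a.
have h3 : U a + C + 2 * `|t| * B + 1 <= D by exact: ler_norm.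
have h4 := hC b ltac:(lra).
have x0 : x <= 0.
  apply/ltW/(lt_le_trans xD); rewrite mulNr oppr_le0 divr_ge0 ?normr_ge0//.
  exact: ltW.
have h5 : x * (b - a) <= x * (m - a) by rewrite ler_wnM2l//; lra.
have h6 : x * (m - a) < - D by move: xD; rewrite ltr_pdivlMr.
by move: h1 Jb; rewrite ler_norml /J; lra.
Qed.

(** The slopes that bound the hull at m form a closed half-line, so the
    infimum that defines position belongs to it. *)
Lemma positionP t m x : 0 < m < 1 -> (X t m <= x) <-> le_hull t m x.
Proof.
move=> m01.
have [x1 hx1] := le_hull_ex t m01; have [x0 hx0] := le_hull_lb t m01.
have hS : has_inf [set x | le_hull t m x] by split; [exists x1|exists x0].
split => [Xx|h]; last by apply: ge_inf => //; exact: hS.2.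
apply: (le_hull_mono m01 Xx); apply: le_hull_closed => // y Xy.
have yX : 0 < y - X t m by lra.
have [z hz zy] := inf_adherent yX hS.
by apply: (le_hull_mono m01 _ hz); move: zy; rewrite -/(X t m); lra.
Qed.

Lemma position_mono t m n : 0 < m -> m <= n -> n < 1 -> X t m <= X t n.
Proof.
move=> m0 mn n1; apply/positionP; first lra.
by apply: (le_hull_anti mn); apply/positionP => //; lra.
Qed.

(** Left continuity in m: position is the left slope of the hull. *)
Lemma position_left t m x : 0 < m < 1 -> (forall n, 0 < n < m -> X t n <= x) ->
  X t m <= x.
Proof.
move=> m01 h; apply/positionP => //; apply: le_hull_left => // n nm.
by apply/positionP; [lra|exact: h].
Qed.

(** k is a contact point of the tilted function with its supporting line of
    slope 0.  For k inside ]0, 1[ this means that k is a minimizer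
    (contact_min); the formulation through nearby almost minimizers also covers
    k = 0 and k = 1, where the value of pot is arbitrary. *)
Definition contact t x k := forall e : R, 0 < e -> exists b : R,
  [/\ 0 < b < 1, `|b - k| < e &
      forall m : R, 0 < m < 1 -> J t x b <= J t x m + e].

Lemma contact_min t x k : 0 < k < 1 -> contact t x k ->
  forall m : R, 0 < m < 1 -> J t x k <= J t x m.
Proof.
move=> k01 h m m01; apply/ler_addgt0Pr => e e0.
have e1 : 0 < e / 2 by lra.
have [d d0 hd] := tilted_loc t x k01 e1.
have [|b [b01 bk Jb]] := h (Num.min d (e / 2)); first by rewrite lt_min d0.
have [|_ ] := hd b; first by move: bk; rewrite lt_min => /andP[].
have := Jb _ m01; have : Num.min d (e / 2) <= e / 2 by rewrite ge_min lexx orbT.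
by rewrite ltr_norml; lra.
Qed.

Lemma min_contact t x k : 0 < k < 1 ->
  (forall m : R, 0 < m < 1 -> J t x k <= J t x m) -> contact t x k.
Proof.
move=> k01 h e e0; exists k; split; rewrite ?subrr ?normr0//.
by move=> m m01; have := h _ m01; lra.
Qed.

Lemma contact_init k : 0 < k < 1 -> contact 0 (q k) k.
Proof.
move=> k01; apply: min_contact => // m m01.
by have := U_sub k01 m01; rewrite /J; lra.
Qed.

(** Each of the two points is tested against the other one.  The potential pot
    cancels when the two inequalities are added, so that only mom remains,
    which is continuous up to the end points. *)
Lemma contact_compare t x k s y l : 0 <= k <= 1 -> 0 <= l <= 1 ->
  contact t x k -> contact s y l -> (t - s) * (V k - V l) <= (x - y) * (k - l).
Proof.
move=> k01 l01 hk hl; apply/ler_addgt0Pr => g g0.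
pose T := `|t - s| + `|x - y| + 1.
have T0 : 0 < T by rewrite /T; have := normr_ge0 (t-s); have := normr_ge0 (x-y); lra.
pose h := g / (2 * T).
have h0 : 0 < h by rewrite /h divr_gt0// mulr_gt0.
have [d d0 hd] := V_uc h0.
pose e := Num.min d h.
have e0 : 0 < e by rewrite lt_min d0.
have ed : e <= d by rewrite ge_min lexx.
have eh : e <= h by rewrite ge_min lexx orbT.
have [b [b01 bk Jb]] := hk _ e0; have [a [a01 al Ja]] := hl _ e0.
have h1 := Jb _ a01; have h2 := Ja _ b01.
have h3 : `|V k - V b| < h by apply: hd; [lra|lra|rewrite distrC; lra].
have h4 : `|V a - V l| < h by apply: hd; [lra|lra|lra].
have h5 : `|(t - s) * (V k - V b + (V a - V l))| <= `|t - s| * (2 * h).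
  rewrite normrM ler_wpM2l//; apply: le_trans (ler_normD _ _) _; lra.
have h6 : `|(x - y) * (b - k + (l - a))| <= `|x - y| * (2 * h).
  rewrite normrM ler_wpM2l//; apply: le_trans (ler_normD _ _) _.
  by move: al; rewrite distrC; lra.
have h7 : T * (2 * h) = g by rewrite /h; field; lra.
have h8 : `|t - s| * (2 * h) + `|x - y| * (2 * h) + 2 * h = g.
  by rewrite -[RHS]h7 /T; ring.
move: h5 h6 h1 h2; rewrite !ler_norml /J.
move: h8 eh; move: (`|t - s| * (2 * h)) (`|x - y| * (2 * h)) => A1 A2.
lra.
Qed.

(** The masses at or on the left of x, and strictly on the left of x, at time t:
    the particles at x are those between alpha and beta.  The value 0 is added
    to make the sets nonempty. *)
Definition beta t x : R := sup [set m | m = 0 \/ (0 < m < 1 /\ X t m <= x)].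
Definition alpha t x : R := sup [set m | m = 0 \/ (0 < m < 1 /\ X t m < x)].

Lemma beta_sup t x : has_sup [set m | m = 0 \/ (0 < m < 1 /\ X t m <= x)].
Proof. by split; [exists 0; left|exists 1 => m /= [->//|[]]; lra]. Qed.

Lemma alpha_sup t x : has_sup [set m | m = 0 \/ (0 < m < 1 /\ X t m < x)].
Proof. by split; [exists 0; left|exists 1 => m /= [->//|[]]; lra]. Qed.

Lemma beta01 t x : 0 <= beta t x <= 1.
Proof.
apply/andP; split; first by apply: ub_le_sup; [exact: (beta_sup t x).2|left].
by apply: ge_sup; [exact: (beta_sup t x).1|move=> m /= [->//|[]]; lra].
Qed.

Lemma alpha01 t x : 0 <= alpha t x <= 1.
Proof.
apply/andP; split; first by apply: ub_le_sup; [exact: (alpha_sup t x).2|left].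
by apply: ge_sup; [exact: (alpha_sup t x).1|move=> m /= [->//|[]]; lra].
Qed.

Lemma betaP t x m : 0 < m < 1 -> (m <= beta t x) <-> (X t m <= x).
Proof.
move=> m01; split => [mb|Xx]; last first.
  by apply: ub_le_sup; [exact: (beta_sup t x).2|right].
apply: position_left => // n nm.
have bn : 0 < beta t x - n by lra.
have [k [->|[k01 Xk]] bk] := sup_adherent bn (beta_sup t x).
  by move: bk; rewrite -/(beta t x); lra.
apply: le_trans Xk; apply: position_mono; move: bk; rewrite -/(beta t x); lra.
Qed.

Lemma alpha_ge t x m : 0 < m < 1 -> X t m < x -> m <= alpha t x.
Proof.
by move=> m01 Xx; apply: ub_le_sup; [exact: (alpha_sup t x).2|right].
Qed.

Lemma alpha_lt t x m : 0 < m < 1 -> m < alpha t x -> X t m < x.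
Proof.
move=> m01 ma; have am : 0 < alpha t x - m by lra.
have [k [->|[k01 Xk]] ak] := sup_adherent am (alpha_sup t x).
  by move: ak; rewrite -/(alpha t x); lra.
apply: le_lt_trans Xk; apply: position_mono; move: ak; rewrite -/(alpha t x); lra.
Qed.

Lemma beta_le_alpha t x y : x < y -> beta t x <= alpha t y.
Proof.
move=> xy; apply: ge_sup; first exact: (beta_sup t x).1.
move=> m /= [->|[m01 Xm]]; first by have := alpha01 t y; lra.
by apply: alpha_ge => //; lra.
Qed.

Lemma alpha_le_beta t x : alpha t x <= beta t x.
Proof.
apply: ge_sup; first exact: (alpha_sup t x).1.
move=> m /= [->|[m01 Xm]]; first by have := beta01 t x; lra.
by apply/betaP => //; lra.
Qed.

(** Beyond beta the hull has slope greater than x and before it slope at most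
    x, so the affine piece of slope x touches the tilted function at beta.  The
    two end points 0 and 1 are approached from inside. *)
Lemma contact_beta t x : contact t x (beta t x).
Proof.
have /andP[b0 b1] := beta01 t x; set k := beta t x in b0 b1 *.
(* Labels m close to 1 have slope at most x, so [m, 1[ contains an almost
   minimizer. *)
have [k1|k1] := eqVneq k 1.
  move=> e e0; have e1 : 0 < e / 2 by lra.
  have [m1 m101 hm1] := tilted_near_inf t x e1.
  pose m := Num.max ((m1 + 1) / 2) (1 - e / 2).
  have n1 : (m1 + 1) / 2 <= m by rewrite le_max lexx.
  have n2 : 1 - e / 2 <= m by rewrite le_max lexx orbT.
  have n3 : m < 1 by rewrite gt_max; lra.
  have m01 : 0 < m < 1 by lra.
  have /(positionP _ _ m01) h : X t m <= x by apply/betaP => //; rewrite -/k; lra.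
  have [|b bm Jb] := h _ m1 e1; first by lra.
  exists b; split; [lra|rewrite k1 ltr_norml; lra|].
  by move=> n n01; have := hm1 _ n01; lra.
have {}k1 : k < 1 by rewrite lt_neqAle k1.
have nle m : 0 < m < 1 -> k < m -> ~ le_hull t m x.
  by move=> m01 km /(positionP _ _ m01)/(betaP _ _ m01); rewrite -/k; lra.
(* No label has slope at most x, so even for m close to 0 some point on the
   left of m is below all of [m, 1[. *)
have [k0|k0] := eqVneq k 0.
  move=> e e0; have e1 : 0 < e / 2 by lra.
  have [m1 m101 hm1] := tilted_near_inf t x e1.
  pose m := Num.min (m1 / 2) (e / 2).
  have n1 : m <= m1 / 2 by rewrite ge_min lexx.
  have n2 : m <= e / 2 by rewrite ge_min lexx orbT.
  have n3 : 0 < m by rewrite lt_min; lra.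
  have m01 : 0 < m < 1 by lra.
  have [a am Ja] : exists2 a, 0 < a < m & forall b, m <= b < 1 -> J t x a < J t x b.
    apply: contrapT => hn; apply: (nle m m01); first by lra.
    move=> e' a e'0 am; apply: contrapT => hb; apply: hn; exists a => // b bm.
    rewrite ltNge; apply/negP => Jba; apply: hb; exists b => //; lra.
  exists a; split; [lra|rewrite k0 ltr_norml; lra|].
  move=> n n01; have := hm1 _ n01; have := Ja m1 ltac:(lra); lra.
have {}k0 : 0 < k by rewrite lt_neqAle eq_sym k0.
have k01 : 0 < k < 1 by lra.
have hk : le_hull t k x by apply/positionP => //; apply/betaP.
apply: min_contact => // m m01; rewrite leNgt; apply/negP => Jmk.
(* A point below k can be found on the right of k, at a positive distance.
   Then a label n between the two also has slope at most x, contrary to the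
   choice of k. *)
have [m' [m'01 km' Jm']] : exists m', [/\ 0 < m' < 1, k <= m' & J t x m' < J t x k].
  have [km|mk] := leP k m; first by exists m.
  have e0 : 0 < (J t x k - J t x m) / 2 by lra.
  have [|b bk Jb] := hk _ m e0; first by lra.
  by exists b; split; lra.
have e0 : 0 < (J t x k - J t x m') / 2 by lra.
have [d d0 hd] := tilted_loc t x k01 e0.
pose n := k + Num.min (d / 2) ((1 - k) / 2).
have n1 : n <= k + d / 2 by rewrite lerD2l ge_min lexx.
have n2 : n <= k + (1 - k) / 2 by rewrite lerD2l ge_min lexx orbT.
have n3 : k < n by rewrite ltrDl lt_min; lra.
have big b : k <= b <= n -> J t x m' < J t x b.
  move=> bk; have [|_ ] := hd b; first by rewrite ltr_norml; lra.
  by rewrite ltr_norml; lra.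
have m'n : n <= m'.
  by rewrite leNgt; apply/negP => m'n; have := big m' ltac:(lra); lra.
apply: (nle n); [lra|by []|] => e a e'0 an.
have [ak|ka] := ltP a k.
  have [|b bk Jb] := hk _ a e'0; first by lra.
  have [nb|bn] := leP n b; first by exists b => //; lra.
  by exists m'; [lra|have := big b ltac:(lra); lra].
by exists m'; [lra|have := big a ltac:(lra); lra].
Qed.

(** alpha is the limit of beta t y as y increases to x. *)
Lemma contact_alpha t x : contact t x (alpha t x).
Proof.
move=> e e0; have e1 : 0 < e / 4 by lra.
have [m hm am] := sup_adherent e1 (alpha_sup t x).
rewrite -/(alpha t x) in am.
have [y [xy yx my]] : exists y, [/\ x - e / 4 <= y, y < x & m <= beta t y].
  case: hm => [->|[m01 Xm]].
    by exists (x - e / 4); split; [lra|lra|have := beta01 t (x - e / 4); lra].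
  exists (Num.max (X t m) (x - e / 4)); split.
  - by rewrite le_max lexx orbT.
  - by rewrite gt_max Xm; lra.
  - by apply/betaP => //; rewrite le_max lexx.
have ba := beta_le_alpha t yx.
have [b [b01 bk Jb]] := contact_beta t y e1.
exists b; split => //; first by move: bk; rewrite !ltr_norml; lra.
move=> n n01; have := Jb _ n01; rewrite /J.
have : `|(x - y) * (b - n)| <= e / 4.
  rewrite normrM -[leRHS]mulr1 ler_pM//; rewrite ler_norml; lra.
rewrite ler_norml; lra.
Qed.

(** Let k <= l be contact points at time t with slopes x < y.  Averaging the
    minimality inequality at time t with the subgradient inequality of the
    convex pot shows that they are contact points at time s with slopes
    (1 - s / t) q k + (s / t) x and (1 - s / t) q l + (s / t) y.  As q is monotone,
    these slopes differ by at least (s / t) (y - x). *)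
Lemma position_stick s t m n : 0 < s -> s <= t -> 0 < m -> m <= n -> n < 1 ->
  s * (X t n - X t m) <= t * (X s n - X s m).
Proof.
move=> s0 st m0 mn n1; have t0 : 0 < t by lra.
have m01 : 0 < m < 1 by lra.
have n01 : 0 < n < 1 by lra.
have [XX|XX] := leP (X t n) (X t m).
  apply: (@le_trans _ _ 0); first by rewrite mulr_ge0_le0//; lra.
  by rewrite mulr_ge0 ?subr_ge0//; [lra|exact: position_mono].
have slope y k : 0 < k < 1 -> (forall b, 0 < b < 1 -> J t y k <= J t y b) ->
    let z := (1 - s / t) * q k + s / t * y in
    forall b, 0 < b < 1 -> J s z k <= J s z b.
  move=> k01 hk z b b01.
  have h1 := hk _ b01; have h2 := U_sub k01 b01.
  have st0 : 0 <= s / t by rewrite divr_ge0//; lra.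
  have st1 : s / t <= 1 by rewrite ler_pdivrMr// mul1r.
  have h3 : 0 <= s / t * (J t y b - J t y k) by rewrite mulr_ge0//; lra.
  have h4 : 0 <= (1 - s / t) * (U b - (U k + q k * (b - k))) by rewrite mulr_ge0//; lra.
  have h5 : s / t * t = s by rewrite divfK//; lra.
  have h6 : s / t * (J t y b - J t y k) = s / t * (U b - U k) + s * (V b - V k) - s / t * y * (b - k).
    by rewrite -[X in _ + X * (V b - V k)]h5 /J; ring.
  move: h3 h4; rewrite h6 /J /z; lra.
have kP y : X t m <= y < X t n -> m <= beta t y < n.
  move=> /andP[my yn]; apply/andP; split; first by apply/betaP.
  by rewrite ltNge; apply/negP => /(betaP _ _ n01); lra.
have kE y : X t m <= y < X t n -> forall b, 0 < b < 1 -> J t y (beta t y) <= J t y b.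
  by move=> /kP k2; apply: contact_min (contact_beta t y); lra.
have main y : X t m < y -> y < X t n -> s * (y - X t m) <= t * (X s n - X s m).
  move=> y1 y2.
  have k1 := kP (X t m) ltac:(lra); have hk1 := kE (X t m) ltac:(lra).
  have k2 := kP y ltac:(lra); have hk2 := kE y ltac:(lra).
  set l1 := beta t (X t m) in k1 hk1; set l2 := beta t y in k2 hk2.
  have l12 : l1 <= l2.
    rewrite /l1 /l2; apply: le_trans (beta_le_alpha t y1) _; exact: alpha_le_beta.
  have qq : q l1 <= q l2 by apply: q_nd; lra.
  have l101 : 0 < l1 < 1 by lra.
  have l201 : 0 < l2 < 1 by lra.
  have := slope _ _ l101 hk1; have := slope _ _ l201 hk2; cbv zeta.
  set z2 := (_ * q l2 + _); set z1 := (_ * q l1 + _) => h2 h1.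
  have a1 : X s m <= z1.
    apply: (@le_trans _ _ (X s l1)); first by apply: position_mono; lra.
    apply/positionP; first lra.
    move=> e a e0 al; exists l1; first lra.
    by have := h1 a ltac:(lra); lra.
  have a2 : z2 <= X s n.
    rewrite leNgt; apply/negP => Xz.
    have /(positionP _ _ n01) hX := lexx (X s n).
    pose e := (z2 - X s n) * (n - l2) / 2.
    have e0 : 0 < e by rewrite /e divr_gt0// mulr_gt0//; lra.
    have [|b bn Jb] := hX _ l2 e0; first by lra.
    have := h2 b ltac:(lra).
    have : (z2 - X s n) * (n - l2) <= (z2 - X s n) * (b - l2) by rewrite ler_wpM2l//; lra.
    move: Jb e0; rewrite /e /J; lra.
  have st1 : 0 <= 1 - s / t by rewrite subr_ge0 ler_pdivrMr// mul1r.
  have h3 : 0 <= (1 - s / t) * (q l2 - q l1) by rewrite mulr_ge0//; lra.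
  have h4 : s / t * (y - X t m) <= X s n - X s m.
    by move: a1 a2 h3; rewrite /z1 /z2; lra.
  have : t * (s / t * (y - X t m)) <= t * (X s n - X s m) by rewrite ler_wpM2l//; lra.
  by have -> : t * (s / t * (y - X t m)) = s * (y - X t m) by field; lra.
apply/ler_addgt0Pr => e e0.
(* The strict inequality y < X t n of main is removed by letting y tend to
   X t n. *)
pose d := Num.min (e / s) ((X t n - X t m) / 2).
have d1 : d <= e / s by rewrite ge_min lexx.
have d2 : d <= (X t n - X t m) / 2 by rewrite ge_min lexx orbT.
have d0 : 0 < d by rewrite lt_min divr_gt0//=; lra.
have := main (X t n - d) ltac:(lra) ltac:(lra).
have : s * d <= e by move: d1; rewrite ler_pdivlMr// mulrC.
lra.
Qed.

End Hull.

(** * Blocks of glued particles and their velocity *)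

Lemma lipschitz_cts (R : realType) (F : R -> R) (K : R) :
  (forall s t, `|F t - F s| <= K * `|t - s|) -> continuous F.
Proof.
move=> FK t.
have K0 : 0 <= K by have := FK 0 1; rewrite subr0 normr1 mulr1; apply: le_trans.
have K1 : 0 < K + 1 by lra.
apply/cvgrPdist_lt => e e0; exists (e / (K + 1)); first exact: divr_gt0.
move=> s /= ts; apply: le_lt_trans (FK s t) _.
apply: (@le_lt_trans _ _ ((K + 1) * `|t - s|)); first by rewrite ler_wpM2r//; lra.
by rewrite mulrC -ltr_pdivlMr.
Qed.

Lemma continuous_near (R : realType) (q : R -> R) (m : R) : {for m, continuous q} -> forall e : R, 0 < e ->
  exists2 d : R, 0 < d & forall b : R, `|b - m| < d -> `|q b - q m| < e.
Proof.
move=> /cvgrPdist_lt qm e e0; have := qm e e0.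
rewrite -nbhs_nearE => /nbhs_ballP[d /= d0 hd]; exists d => // b bd.
by rewrite distrC; apply: hd; rewrite /ball /= distrC.
Qed.

Section Flow.
Variables (R : realType) (p : flow_data R).
Local Notation q := (initpos p).
Local Notation c := (initvel p).
Local Notation V := (mom p).
Local Notation q_nd := (@initpos_nd R p).
Local Notation U_sub := (@pot_sub R p _ _).
Local Notation V_uc := (@mom_uc R p _).
Local Notation V_lip := (@mom_lip R p _).
Local Notation J := (tilted p).
Local Notation X := (position p).
Local Notation alpha := (alpha p).
Local Notation beta := (beta p).

(** Changing t by h changes the increments of the tilted function across m by at
    most h times those of mom, which are controlled by mom_lip; a change of
    slope by K h compensates for this. *)
Lemma position_lip m : 0 < m < 1 -> exists2 K : R, 0 <= K &
  forall s t : R, `|X t m - X s m| <= K * `|t - s|.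
Proof.
move=> m01; have [K K0 hK] := V_lip m01; exists K => // s t.
have main s' t' : X s' m <= X t' m + K * `|t' - s'|.
  apply/positionP => // e a e0 am.
  have /(positionP _ _ _ m01) h := lexx (X t' m).
  have [b bm Jb] := h e a e0 am; exists b => //.
  have := hK a b am bm => Vab.
  have : `|(t' - s') * (V b - V a)| <= `|t' - s'| * (K * (b - a)).
    by rewrite normrM ler_wpM2l.
  by move: Jb; rewrite ler_norml /J; lra.
rewrite ler_distl; have := main s t; have := main t s.
by rewrite (distrC s t); lra.
Qed.

(** At a contact point where pot is differentiable, the derivative of the tilted
    function vanishes. *)
Lemma contact_slope t x m : 0 < m < 1 -> {for m, continuous q} ->
  (forall b : R, 0 < b < 1 -> J t x m <= J t x b) -> x = q m + t * c m.
Proof.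
move=> m01 qm hm.
suff key e : 0 < e -> `|x - (q m + t * c m)| <= e * (1 + `|t|).
  apply/eqP; rewrite -subr_eq0 -normr_le0; apply/ler_addgt0Pr => e e0.
  have t0 : 0 < 1 + `|t| by have := normr_ge0 t; lra.
  by have := key _ (divr_gt0 e0 t0); rewrite divfK ?gt_eqF// add0r.
move=> e0.
have [d1 d10 h1] := continuous_near qm e0; have [d2 d20 h2] := mom_diff m01 qm e0.
pose h := Num.min (Num.min (d1 / 2) (d2 / 2)) (Num.min (m / 2) ((1 - m) / 2)).
have h0 : 0 < h by rewrite /h !lt_min; lra.
have hd1 : h <= d1 / 2 by rewrite /h !ge_min lexx.
have hd2 : h <= d2 / 2 by rewrite /h !ge_min lexx orbT.
have hm1 : h <= m / 2 by rewrite /h !ge_min lexx !orbT.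
have hm2 : h <= (1 - m) / 2 by rewrite /h !ge_min lexx !orbT.
clearbody h.
have step b s : b = m + s -> `|s| = h ->
    x * s <= (q m + t * c m) * s + e * (1 + `|t|) * h.
  move=> bE sh.
  have sl : - h <= s <= h by rewrite -ler_norml sh.
  have b01 : 0 < b < 1 by lra.
  have bm : b - m = s by lra.
  have Jb := hm _ b01.
  have Ub := U_sub b01 m01.
  have q1 := h1 b; have V1 := h2 b; rewrite bm sh in q1 V1.
  have {}q1 := q1 ltac:(lra); have {}V1 := V1 ltac:(lra).
  have h4 : `|(q b - q m) * s| <= e * h.
    by rewrite normrM sh ler_wpM2r//; lra.
  have h5 : `|t * (V b - V m - c m * s)| <= `|t| * (e * h).
    by rewrite normrM ler_wpM2l.
  move: h4 h5; rewrite !ler_norml; move: Ub Jb; rewrite bE /J.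
  rewrite (_ : m - (m + s) = - s); first lra.
  by ring.
have s1 := step _ h erefl ltac:(exact: gtr0_norm).
have s2 := step _ (- h) erefl ltac:(by rewrite normrN gtr0_norm).
rewrite ler_norml; apply/andP; split.
- by rewrite -(ler_pM2r h0); lra.
- by rewrite -(ler_pM2r h0); lra.
Qed.

(** At time 0 the hull is pot itself, whose left slope is q at every point of
    continuity. *)
Lemma position_init m : 0 < m < 1 -> {for m, continuous q} -> X 0 m = q m.
Proof.
move=> m01 qm; apply/eqP; rewrite eq_le; apply/andP; split.
  apply/positionP => // e a e0 am; exists m; first lra.
  have a01 : 0 < a < 1 by lra.
  by have := U_sub m01 a01; rewrite /J; lra.
apply/ler_addgt0Pr => e e0; have e1 : 0 < e / 2 by lra.
have [d d0 hd] := continuous_near qm e1.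
pose a := Num.max (m / 2) (m - d / 2).
have a1 : m / 2 <= a by rewrite le_max lexx.
have a2 : m - d / 2 <= a by rewrite le_max lexx orbT.
have a3 : a < m by rewrite gt_max; lra.
have am : 0 < a < m by lra.
have a01 : 0 < a < 1 by lra.
have qa : q m - e / 2 < q a.
  have [|] := andP (_ : (- (e/2) < q a - q m < e / 2)); last by lra.
  by rewrite -ltr_norml; apply: hd; rewrite ltr_norml; lra.
rewrite leNgt; apply/negP => Xq.
have /(positionP _ _ _ m01) h := lexx (X 0 m).
have g0 : 0 < (e / 2) * (m - a) / 2 by rewrite divr_gt0// mulr_gt0//; lra.
have [b bm Jb] := h _ a g0 am.
have b01 : 0 < b < 1 by lra.
have := U_sub a01 b01.
have : 0 <= (q a - X 0 m - e / 2) * (b - a) by rewrite mulr_ge0//; lra.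
have : e / 2 * (m - a) <= e / 2 * (b - a) by rewrite ler_wpM2l//; lra.
move: Jb g0; rewrite /J; lra.
Qed.

(** The mean initial velocity of the particles glued at x.  Where no mass is
    glued, the particle k = beta t x has been free up to time t: if it sits at x
    and q is continuous at k, then x = q k + t c k and the quotient is c k.  For
    positions x without particle, the same formula respects the one-sided
    Lipschitz bound. *)
Definition vel t x : R :=
  if alpha t x < beta t x then (V (beta t x) - V (alpha t x)) / (beta t x - alpha t x)
  else (x - q (beta t x)) / t.

Lemma beta_ge t m : 0 < m < 1 -> m <= beta t (X t m).
Proof. by move=> m01; apply/betaP. Qed.

Lemma alpha_le t m : 0 < m < 1 -> alpha t (X t m) <= m.
Proof.
move=> m01; rewrite leNgt; apply/negP => ma.
by have := alpha_lt m01 ma; rewrite ltxx.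
Qed.

(** Comparison of the block at x with an initial particle on its left: the mean
    speed of the block is at most that of a particle which would have travelled
    from q k to x. *)
Lemma vel_upper t x k : 0 < t -> 0 < k -> k <= alpha t x -> alpha t x < 1 ->
  t * vel t x <= x - q k.
Proof.
move=> t0 k0 ka a1; have ab := alpha_le_beta p t x.
have qk : q k <= q (alpha t x) by apply: q_nd.
have b01 := beta01 p t x.
rewrite /vel; case: ltP => [ab'|ba]; last first.
  have -> : beta t x = alpha t x by apply: le_anti; rewrite ba.
  by rewrite mulrC divfK; lra.
set a := alpha t x in ka a1 ab qk ab' *; set b := beta t x in ab b01 ab' *.
have a01 : 0 < a < 1 by lra.
have a01' : 0 <= a <= 1 by lra.
have := contact_compare b01 a01' (contact_beta p t x) (contact_init p a01).
rewrite subr0 => h; rewrite mulrA ler_pdivrMr; last lra.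
apply: (le_trans h); rewrite ler_wpM2r//; lra.
Qed.

Lemma vel_lower t x k : 0 < t -> 0 < beta t x -> beta t x <= k -> k < 1 ->
  x - q k <= t * vel t x.
Proof.
move=> t0 b0 bk k1; have ab := alpha_le_beta p t x.
have qk : q (beta t x) <= q k by apply: q_nd.
have a01 := alpha01 p t x.
rewrite /vel; case: ltP => [ab'|ba]; last first.
  by rewrite mulrC divfK; lra.
set a := alpha t x in ab a01 ab' *; set b := beta t x in b0 bk ab qk ab' *.
have b01 : 0 < b < 1 by lra.
have b01' : 0 <= b <= 1 by lra.
have := contact_compare a01 b01' (contact_alpha p t x) (contact_init p b01).
rewrite subr0 => h; rewrite mulrA ler_pdivlMr; last lra.
have : (x - q k) * (b - a) <= (x - q b) * (b - a) by rewrite ler_wpM2r//; lra.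
lra.
Qed.

(** For x < y the label k = beta t x ends the block of x and does not exceed the
    start of the block of y.  Hence t v(x) >= x - q k and t v(y) <= y - q k, and
    q k cancels in the difference. *)
Lemma vel_entropy t x y : 0 < t -> 0 < beta t x -> 0 < beta t y ->
  alpha t x < 1 -> alpha t y < 1 ->
  (vel t x - vel t y) * (x - y) <= t^-1 * (x - y) ^+ 2.
Proof.
move=> t0.
have main x' y' : 0 < beta t x' -> alpha t y' < 1 -> x' < y' ->
    (vel t y' - vel t x') * (y' - x') <= t^-1 * (y' - x') ^+ 2.
  move=> k0 a1 xy; have ba := beta_le_alpha p t xy.
  have h3 := vel_upper t0 k0 ba a1.
  have h4 := vel_lower t0 k0 (lexx _) ltac:(lra).
  rewrite expr2 mulrA ler_wpM2r ?subr_ge0 ?(ltW xy)//.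
  by rewrite mulrC ler_pdivlMr//; lra.
move=> bx by_ ax ay; have [xy|yx|->] := ltgtP x y.
- have := main _ _ bx ay xy; rewrite !expr2; lra.
- exact: main.
- by rewrite !subrr mulr0 expr0n/= mulr0.
Qed.

(** Blocks only grow: particles that are glued remain glued. *)
Lemma alpha_nincr s t m : 0 < s -> s <= t -> 0 < m < 1 ->
  alpha t (X t m) <= alpha s (X s m).
Proof.
move=> s0 st m01; apply: ge_sup; first exact: (alpha_sup p t _).1.
move=> n /= [->|[n01 Xn]]; first by have := alpha01 p s (X s m); lra.
apply: alpha_ge => //.
have nm : n <= m.
  by rewrite leNgt; apply/negP => mn; have := position_mono p t (_ : 0 < m) (ltW mn) ltac:(lra); lra.
have := position_stick p s0 st (_ : 0 < n) nm ltac:(lra).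
have h : 0 < s * (X t m - X t n) by rewrite mulr_gt0//; lra.
move=> /(_ ltac:(lra)) h'.
have : 0 < t * (X s m - X s n) by lra.
by rewrite pmulr_rgt0; lra.
Qed.

Lemma position_merge s t m n : 0 < s -> s <= t -> 0 < m < 1 -> 0 < n < 1 ->
  X s m = X s n -> X t m = X t n.
Proof.
move=> s0 st.
have main k l : 0 < k -> k <= l -> l < 1 -> X s k = X s l -> X t k = X t l.
  move=> k0 kl l1 E; apply/eqP; rewrite eq_le position_mono//=.
  have := position_stick p s0 st k0 kl l1; rewrite E subrr mulr0.
  by rewrite pmulr_rle0// subr_le0.
move=> m01 n01 E; have [mn|nm] := leP m n.
- by apply: main => //; lra.
- by apply/esym/main => //; lra.
Qed.

Lemma beta_nd s t m : 0 < s -> s <= t -> 0 < m < 1 ->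
  beta s (X s m) <= beta t (X t m).
Proof.
move=> s0 st m01; apply: ge_sup; first exact: (beta_sup p s _).1.
move=> n /= [->|[n01 Xn]]; first by have := beta01 p t (X t m); lra.
apply/betaP => //.
have [nm|mn] := leP n m; first by apply: position_mono; lra.
rewrite le_eqVlt; apply/orP; left; apply/eqP.
apply: (position_merge s0 st) => //; apply/eqP; rewrite eq_le Xn/=.
by apply: position_mono; lra.
Qed.

(** The particle m has collided with no other one at time t. *)
Definition single t m := ~~ (alpha t (X t m) < beta t (X t m)).

Lemma single_eq t m : 0 < m < 1 -> single t m ->
  alpha t (X t m) = m /\ beta t (X t m) = m.
Proof.
move=> m01; rewrite /single -leNgt => h.
have := beta_ge t m01; have := alpha_le t m01.
by split; apply: le_anti; lra.
Qed.

Lemma single_position t m : 0 < m < 1 -> {for m, continuous q} -> single t m ->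
  X t m = q m + t * c m.
Proof.
move=> m01 qm /(single_eq m01)[_ bm]; apply: contact_slope => //.
by apply: contact_min => //; rewrite -[X in contact _ _ _ X]bm; exact: contact_beta.
Qed.

Lemma single_vel t m : 0 < t -> 0 < m < 1 -> {for m, continuous q} ->
  single t m -> vel t (X t m) = c m.
Proof.
move=> t0 m01 qm st; rewrite /vel ifN//.
have [_ ->] := single_eq m01 st; rewrite single_position//.
by rewrite addrAC subrr add0r mulrAC divff ?mul1r// gt_eqF.
Qed.

Lemma single_anti s t m : 0 < s -> s <= t -> 0 < m < 1 -> single t m -> single s m.
Proof.
move=> s0 st m01; rewrite /single -!leNgt.
have := alpha_nincr s0 st m01; have := beta_nd s0 st m01; lra.
Qed.

(** The state of m just after t is known: m is already glued at time t, or it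
    is still alone some time later.  This fails at most at one time, the instant
    at which m starts to collide (unresolved_eq). *)
Definition resolved t m :=
  ~~ single t m \/ exists2 s, t < s & single s m.

Lemma unresolved_eq s t m : 0 < s -> 0 < t -> 0 < m < 1 ->
  ~ resolved s m -> ~ resolved t m -> s = t.
Proof.
move=> s0 t0 m01 hs ht.
have sg r : ~ resolved r m -> single r m.
  by move=> h; apply: contrapT => /negP h1; apply: h; left.
have [st|ts|//] := ltgtP s t.
- by exfalso; apply: hs; right; exists t => //; exact: sg.
- by exfalso; apply: ht; right; exists s => //; exact: sg.
Qed.

(** A particle outside the block of m is at positive distance from it and by
    position_lip needs some time to reach it. *)
Lemma block_right_cont t m : 0 < t -> 0 < m < 1 -> forall e : R, 0 < e ->
  exists2 d : R, 0 < d & forall s : R, t < s < t + d ->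
    beta s (X s m) <= beta t (X t m) + e /\
    alpha t (X t m) - e <= alpha s (X s m).
Proof.
move=> t0 m01 e e0.
have sep k l : 0 < k < 1 -> 0 < l < 1 -> X t k < X t l ->
    exists2 d : R, 0 < d & forall s : R, t < s < t + d -> X s k < X s l.
  move=> k01 l01 kl.
  have [K K0 hK] := position_lip k01; have [L L0 hL] := position_lip l01.
  have g0 : 0 < X t l - X t k by lra.
  have KL : 0 < K + L + 1 by lra.
  exists ((X t l - X t k) / (K + L + 1)); first exact: divr_gt0.
  move=> s sd; have h1 := hK t s; have h2 := hL t s.
  have : (s - t) * (K + L + 1) < X t l - X t k by rewrite -ltr_pdivlMr//; lra.
  move: h1 h2; rewrite (gtr0_norm (_ : 0 < s - t)); last lra.
  rewrite !ler_norml; lra.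
have [d1 d10 h1] : exists2 d : R, 0 < d & forall s : R, t < s < t + d ->
    beta s (X s m) <= beta t (X t m) + e.
  have [b1|b1] := leP 1 (beta t (X t m) + e).
    by exists 1 => // s _; have := beta01 p s (X s m); lra.
  have bm := beta_ge t m01.
  have : 0 < beta t (X t m) + e < 1 by lra.
  set n := beta t (X t m) + e => n01.
  have Xn : X t m < X t n.
    by rewrite ltNge; apply/negP => /(betaP _ _ _ n01); rewrite /n; lra.
  have [d d0 hd] := sep _ _ m01 n01 Xn; exists d => // s sd.
  rewrite leNgt; apply/negP => nb; have := hd _ sd.
  by rewrite ltNge => /negP; apply; apply/betaP => //; exact: ltW.
have [d2 d20 h2] : exists2 d : R, 0 < d & forall s : R, t < s < t + d ->
    alpha t (X t m) - e <= alpha s (X s m).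
  have [b1|b1] := leP (alpha t (X t m) - e) 0.
    by exists 1 => // s _; have := alpha01 p s (X s m); lra.
  have bm := alpha_le t m01.
  have : 0 < alpha t (X t m) - e < 1 by lra.
  set n := alpha t (X t m) - e => n01.
  have Xn : X t n < X t m by apply: alpha_lt => //; rewrite /n; lra.
  have [d d0 hd] := sep _ _ n01 m01 Xn; exists d => // s sd.
  by apply: alpha_ge => //; exact: hd.
exists (Num.min d1 d2); first by rewrite lt_min d10.
move=> s /andP[ts sd]; move: sd; rewrite -ltrBlDl lt_min => /andP[sd1 sd2].
by split; [apply: h1|apply: h2]; lra.
Qed.

(** If a block of width close to w carries momentum at least v w - h, its
    displacement D over a time r is at least about v r.  The width that enters
    the comparison is w1, at distance at most h from w. *)
Lemma slope_lower_bound (v e w h r D dV w1 : R) : 0 < r -> 0 < w -> 0 < e ->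
  h * (1 + `|v| + e) = e * w -> w <= w1 <= w + h -> v * w - h < dV ->
  r * dV <= D * w1 -> (v - e) * r <= D.
Proof.
move=> r0 w0 e0 hE w1E vV DV; rewrite leNgt; apply/negP => Dl.
have x1 : D * w1 < (v - e) * r * w1 by rewrite ltr_pM2r//; lra.
have x2 : (v - e) * (w1 - w) <= (`|v| + e) * h.
  apply: (@le_trans _ _ ((`|v| + e) * (w1 - w))).
    by rewrite ler_wpM2r//; [lra|have := ler_norm v; lra].
  by rewrite ler_wpM2l//; [have := normr_ge0 v; lra|lra].
have x3 : r * (v * w - h) < r * dV by rewrite ltr_pM2l.
have x4 : r * ((v - e) * w1) <= r * (v * w - h) by rewrite ler_pM2l//; lra.
lra.
Qed.

(** A free particle moves with its initial velocity.  For a glued particle,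
    compare the end points of its blocks at times t and s crosswise, beta with
    alpha: contact_compare bounds the displacement by the increment of mom over
    nearly the same interval, and the blocks converge as s decreases to t. *)
Lemma position_right_deriv t m : 0 < t -> 0 < m < 1 -> {for m, continuous q} ->
  resolved t m -> forall e : R, 0 < e -> exists2 d : R, 0 < d &
  forall s : R, t < s < t + d ->
    `|X s m - X t m - vel t (X t m) * (s - t)| <= e * (s - t).
Proof.
move=> t0 m01 qm [ab|[s0 ts0 ss0]] e e0; last first.
  exists (s0 - t); first lra.
  move=> s ts.
  have st : single t m by apply: single_anti ss0 => //; lra.
  have ss : single s m by apply: single_anti ss0 => //; lra.
  rewrite (single_vel t0)// !single_position//.
  have -> : q m + s * c m - (q m + t * c m) - c m * (s - t) = 0 by ring.
  by rewrite normr0 mulr_ge0//; lra.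
move: ab; rewrite /single negbK => ab.
pose w := beta t (X t m) - alpha t (X t m).
have w0 : 0 < w by rewrite /w subr_gt0.
pose v := vel t (X t m).
have vE : v * w = V (beta t (X t m)) - V (alpha t (X t m)).
  by rewrite /v /vel ab divfK// gt_eqF.
have N0 : 0 < 1 + `|v| + e by have := normr_ge0 v; lra.
pose h := e * w / (1 + `|v| + e).
have h0 : 0 < h by rewrite /h divr_gt0// mulr_gt0.
have hE : h * (1 + `|v| + e) = e * w by rewrite divfK// gt_eqF.
have [d1 d10 hd1] := V_uc h0.
pose h' := Num.min h (d1 / 2).
have h'0 : 0 < h' by rewrite lt_min h0; lra.
have h'h : h' <= h by rewrite ge_min lexx.
have h'd : h' <= d1 / 2 by rewrite ge_min lexx orbT.
have [d d0 hd] := block_right_cont t0 m01 h'0.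
exists d => // s ts.
have [bs as_] := hd _ ts.
have bs' := beta_nd t0 (_ : t <= s) m01.
have as' := alpha_nincr t0 (_ : t <= s) m01.
have {}bs' := bs' ltac:(lra); have {}as' := as' ltac:(lra).
have b01 := beta01 p t (X t m); have a01 := alpha01 p t (X t m).
have b01' := beta01 p s (X s m); have a01' := alpha01 p s (X s m).
(* End points are paired crosswise, so that the difference of the labels is
   bounded away from 0. *)
have P1 := contact_compare b01' a01 (contact_beta p s (X s m)) (contact_alpha p t (X t m)).
have P2 := contact_compare a01' b01 (contact_alpha p s (X s m)) (contact_beta p t (X t m)).
have V1 := hd1 _ _ b01' b01; have V2 := hd1 _ _ a01' a01.
move: vE P1 P2 V1 V2 bs as_ bs' as'; rewrite /w.
set bt := beta t _; set at_ := alpha t _; set bs := beta s _; set as_ := alpha s _.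
move=> vE P1 P2 V1 V2 h1 h2 h3 h4.
have {}V1 : `|V bs - V bt| < h by apply: V1; rewrite ltr_norml; lra.
have {}V2 : `|V as_ - V at_| < h by apply: V2; rewrite ltr_norml; lra.
have hE' : h * (1 + `|v| + e) = e * (bt - at_) by rewrite hE.
have st0 : 0 < s - t by lra.
set D := X s m - X t m in P1 P2 *.
move: V1 V2; rewrite -/v !ltr_norml => V1 V2.
have lo : (v - e) * (s - t) <= D.
  apply: (@slope_lower_bound _ _ (bt - at_) h _ _ (V bs - V at_) (bs - at_)) => //; lra.
have up : (- v - e) * (s - t) <= - D.
  by apply: (@slope_lower_bound _ _ (bt - at_) h _ _ (V as_ - V bt) (bt - as_));
    rewrite ?normrN//; lra.
by rewrite ler_norml; lra.
Qed.

End Flow.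

(** * Integration over time *)

Section FTC.
Variable R : realType.
Local Notation mu := (@lebesgue_measure R).

Definition translation (d : R) : measurableTypeR R -> measurableTypeR R := fun t => t + d.

Lemma measurable_translation (d : R) : measurable_fun setT (translation d).
Proof. exact: measurable_funD. Qed.

HB.instance Definition _ (d : R) := @isMeasurableFun.Build _ _ _ _ (translation d) (measurable_translation d).

Lemma translation_pushforward (d : R) (A : set (measurableTypeR R)) : measurable A ->
  pushforward mu (translation d) A = mu A.
Proof.
move=> mA; apply/esym; apply: lebesgue_measure_unique mA => I [[a b] /= _ <-].
rewrite /pushforward.
have -> : translation d @^-1` `]a, b] = `]a - d, b - d]%classic.
  by apply/seteqP; split => t /=; rewrite /translation !in_itv/=; lra.
rewrite !lebesgue_measure_itv/= !lte_fin ltrD2r; case: ifPn => // _.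
by rewrite -!EFinD; congr EFin; ring.
Qed.

Lemma integral_shift (d : R) (f : R -> R) :
  measurable_fun setT f -> mu.-integrable `]d, +oo[ (EFin \o f) ->
  (\int[mu]_(t in `]0%R, +oo[) (f (t + d))%:E = \int[mu]_(t in `]d, +oo[) (f t)%:E)%E.
Proof.
move=> mf fi.
have E : translation d @^-1` `]d, +oo[ = `]0, +oo[%classic.
  by apply/seteqP; split => t /=; rewrite /translation !in_itv/= !andbT; lra.
have tr (g : measurableTypeR R -> \bar R) :
    (\int[mu]_(t in `]d, +oo[) g t =
     \int[pushforward mu (translation d)]_(t in `]d, +oo[) g t)%E.
  pose nu : {measure set (measurableTypeR R) -> \bar R} :=
    measure_function_pushforward__canonical__measure_function_Measure mu (measurable_translation d).
  have nuE A : nu A = pushforward mu (translation d) A by [].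
  apply: (@eq_measure_integral _ _ _ _ nu mu g) => A mA _.
  by rewrite nuE translation_pushforward.
rewrite tr integral_pushforward//= ?E//.
  exact/measurable_EFinP.
have := fi => /integrableP[_ fi'].
apply/integrableP; split.
  apply/measurable_EFinP; apply: measurableT_comp => //; exact: measurable_funTS.
move: fi'; rewrite tr.
rewrite ge0_integral_pushforward//= ?E//.
have mf' : measurable_fun setT (EFin \o (fun t => `|f t|)).
  by apply/measurable_EFinP; exact: measurableT_comp.
exact: measurable_funTS mf'.
Qed.

Lemma integrable_step (C T : R) :
  mu.-integrable `]0%R, +oo[ (fun t : R => (C * \1_(`]0%R, T]%classic) t)%:E).
Proof.
have h : mu.-integrable setT (EFin \o \1_(`]0%R, T]%classic : set R)).
  exact: (@integrable_indic_itv R 0 T false false).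
have h2 : mu.-integrable setT (fun t : R => C%:E * (EFin \o \1_(`]0%R, T]%classic : set R)) t)%E.
  by apply: integrableZl.
apply: (@integrableS _ _ _ _ setT) => //.
Qed.

Lemma integrable_compact_supp (C T : R) (f : R -> R) :
  measurable_fun (`]0%R, +oo[%classic : set R) f -> (forall t, 0 < t -> `|f t| <= C) ->
  (forall t, T < t -> f t = 0) -> mu.-integrable `]0%R, +oo[ (EFin \o f).
Proof.
move=> mf fC fT.
apply: (@le_integrable _ _ _ mu _ _ _ (fun t => (C * \1_(`]0%R, T]%classic) t)%:E)) => //.
- exact/measurable_EFinP.
- move=> t /=; rewrite in_itv/= andbT => t0; rewrite lee_fin.
  have [tT|Tt] := leP t T.
    rewrite indicE mem_set ?mulr1/= ?in_itv/= ?t0//.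
    by apply: le_trans (fC _ t0) _; exact: ler_norm.
  by rewrite fT// normr0.
- exact: integrable_step.
Qed.

Lemma time_integral_finite (M T : R) (f : R -> \bar R) : 0 <= M ->
  measurable_fun (`]0%R, +oo[%classic : set R) f -> (forall t : R, 0 <= f t)%E ->
  (forall t : R, 0 < t -> (f t <= M%:E)%E) -> (forall t : R, T < t -> f t = 0%E) ->
  (\int[mu]_(t in `]0%R, +oo[) f t < +oo)%E.
Proof.
move=> M0 mf f0 fM fT.
have iS := integrable_step M T.
apply: (@le_lt_trans _ _ (\int[mu]_(t in `]0%R, +oo[) (M * \1_(`]0%R, T]%classic : set R) t)%:E)%E); last first.
  have : (\int[mu]_(t in `]0%R, +oo[) (M * \1_(`]0%R, T]%classic : set R) t)%:E)%E \is a fin_num.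
    exact: integrable_fin_num iS.
  by rewrite fin_numElt => /andP[].
apply: ge0_le_integral => //.
- exact: (measurable_int _ iS).
- move=> t /=; rewrite in_itv/= andbT => t0.
  have [tT|Tt] := leP t T; last by rewrite fT// lee_fin mulr_ge0.
  rewrite indicE mem_set/= ?in_itv/= ?t0// mulr1.
  exact: fM.
Qed.

(** The difference quotients n (F (t + 1 / n) - F t) are bounded by the Lipschitz
    constant and have integral - n int_0^(1 / n) F, which tends to - F 0; dominated
    convergence concludes.  A derivative from the right, along a sequence, is
    enough. *)
Lemma lipschitz_right_ftc (F G : R -> R) (K T : R) :
  (forall s t, `|F t - F s| <= K * `|t - s|) ->
  (forall t, T <= t -> F t = 0) ->
  measurable_fun (`]0%R, +oo[%classic : set R) G ->
  {ae mu, forall t : R, 0 < t ->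
     (fun n => n.+1%:R * (F (t + n.+1%:R^-1) - F t)) @ \oo --> G t} ->
  mu.-integrable `]0%R, +oo[ (EFin \o G) /\
  (\int[mu]_(t in `]0%R, +oo[) (G t)%:E = (- F 0)%:E)%E.
Proof.
move=> FK FT mG FG.
have K0 : 0 <= K by have := FK 0 1; rewrite subr0 normr1 mulr1; apply: le_trans.
have K1 : 0 < K + 1 by lra.
have cF : continuous F := lipschitz_cts FK.
have mF : measurable_fun setT F by exact: continuous_measurable_fun.
pose M := K * `|T|.
have FM t : 0 < t -> `|F t| <= M.
  move=> t0; have [Tt|tT] := leP T t; first by rewrite FT// normr0 mulr_ge0.
  have := FK T t; rewrite (FT T)// subr0 => /le_trans; apply.
  rewrite ler_wpM2l// distrC ger0_norm ?subr_ge0 ?(ltW tT)//.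
  by move: (ler_norm T); lra.
pose d n : R := n.+1%:R^-1.
have d0 n : 0 < d n by rewrite /d invr_gt0.
have iF : mu.-integrable `]0%R, +oo[ (EFin \o F).
  apply: (@integrable_compact_supp M T) => //; first exact: measurable_funTS.
  by move=> t Tt; apply: FT; exact: ltW.
have iFd n : mu.-integrable `]0%R, +oo[ (EFin \o (fun t => F (t + d n))).
  apply: (@integrable_compact_supp M T) => //.
  - apply: measurable_funTS; apply: measurableT_comp => //.
    exact: measurable_translation.
  - by move=> t t0; apply: FM; have := d0 n; lra.
  - by move=> t Tt; apply: FT; have := d0 n; lra.
have mD : measurable (`]0%R, +oo[%classic : set R) by exact: measurable_itv.
pose f_ n t := (n.+1%:R * (F (t + d n) - F t))%R.
have mf_ n : measurable_fun (`]0%R, +oo[%classic : set R) (f_ n).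
  apply: measurable_funM; first exact: measurable_cst.
  apply: measurable_funB; last exact: measurable_funTS.
  apply: measurable_funTS; apply: measurableT_comp => //.
  exact: measurable_translation.
have f_K n t : 0 < t -> `|f_ n t| <= K * \1_(`]0%R, `|T|]%classic) t.
  move=> t0; have [tT|Tt] := leP t `|T|.
    rewrite indicE mem_set ?mulr1/= ?in_itv/= ?t0// /f_ normrM ger0_norm//.
    have := FK t (t + d n); rewrite (_ : t + d n - t = d n); last by ring.
    rewrite (gtr0_norm (d0 n)) => h.
    by rewrite mulrC -ler_pdivlMr.
  have Tt' : T <= t by apply: le_trans (ler_norm T) (ltW Tt).
  rewrite /f_ (FT _ Tt') FT; last by have := d0 n; lra.
  by rewrite subrr mulr0 normr0 mulr_ge0.
have [|||||iG _ cvgf] := @dominated_convergence _ _ _ mu _ mD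
   (fun n t => (f_ n t)%:E) (EFin \o G) (fun t => (K * \1_(`]0%R, `|T|]%classic) t)%:E).
- move=> n; apply/measurable_EFinP; exact: mf_.
- by apply/measurable_EFinP.
- move: FG; apply: (@filterS _ _ (ae_filter_ringOfSetsType mu)) => t FGt /=; rewrite in_itv/= andbT => t0.
  by apply: cvg_EFin; [exact: nearW|exact: FGt].
- exact: integrable_step.
- apply: aeW => t /=; rewrite in_itv/= andbT => t0 n.
  by rewrite lee_fin; exact: f_K.
split => //.
(* Translation invariance turns the integral of the difference quotient into
   an integral over the short interval ]0, d n]. *)
pose r_ n := n.+1%:R * - \int[mu]_(x in `]0%R, d n]) F x.
have f_r n : (\int[mu]_(x in `]0%R, +oo[) (f_ n x)%:E)%E = (r_ n)%:E.
  have i1 : mu.-integrable `]0%R, +oo[ (EFin \o (fun t => F (t + d n) - F t)).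
    exact: (@integrableB _ _ _ mu _ mD _ _ (iFd n) iF).
  have -> : (\int[mu]_(x in `]0%R, +oo[) (f_ n x)%:E)%E =
     (\int[mu]_(x in `]0%R, +oo[) f_ n x)%:E.
    rewrite fineK//; apply: integrable_fin_num => //.
    exact: (@integrableZl _ _ _ mu _ mD n.+1%:R _ i1).
  congr EFin; rewrite /f_ /r_ RintegralZl//; congr (_ * _).
  rewrite RintegralB//.
  have -> : \int[mu]_(x in `]0%R, +oo[) F (x + d n) = \int[mu]_(x in `]d n, +oo[) F x.
    rewrite /Rintegral integral_shift//.
    apply: integrableS iF => //; apply: subset_itv => //.
    by rewrite bnd_simp; exact: ltW.
  by rewrite -(Rintegral_itvB iF)//; [ring|rewrite bnd_simp; exact: ltW].
have r_F n : `|r_ n + F 0| <= K * d n.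
  have iF1 : mu.-integrable `]0%R, d n] (EFin \o F).
    by apply: integrableS iF => //; exact: subset_itv.
  have ic (k : R) : mu.-integrable `]0%R, d n] (EFin \o cst k).
    apply: measurable_bounded_integrable => //; last exact: bounded_cst.
    by rewrite /= lebesgue_measure_itv/= lte_fin d0 -EFinB ltry.
  have cE (k : R) : \int[mu]_(x in `]0%R, d n]) k = k * d n.
    by rewrite Rintegral_cst//= lebesgue_measure_itv/= lte_fin d0 -EFinB/= subr0.
  have -> : r_ n + F 0 = - (n.+1%:R * \int[mu]_(x in `]0%R, d n]) (F x - F 0)).
    rewrite RintegralB//; last exact: ic.
    by rewrite cE /r_ /d; field; rewrite nat1r pnatr_eq0.
  rewrite normrN normrM ger0_norm// mulrC -ler_pdivlMr//.
  apply: le_trans (le_normr_Rintegral _ _) _ => //.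
    exact: (@integrableB _ _ _ mu _ (measurable_itv _) _ _ iF1 (ic (F 0))).
  rewrite -[leRHS]cE; apply: le_Rintegral => //.
  - apply: (@integrable_norm _ _ _ mu _ (fun x => F x - F 0)).
    exact: (@integrableB _ _ _ mu _ (measurable_itv _) _ _ iF1 (ic (F 0))).
  - exact: ic.
  - move=> x /=; rewrite in_itv/= => x0; apply: le_trans (FK 0 x) _.
    by rewrite ler_wpM2l// subr0 gtr0_norm; lra.
have cr : (r_ n)%:E @[n --> \oo] --> (- F 0)%:E.
  apply: cvg_EFin; first exact: nearW.
  apply/cvgrPdist_le => e e0; near=> n => /=.
  rewrite distrC opprK; apply: le_trans (r_F n) _.
  apply: (@le_trans _ _ ((K + 1) * d n)); first by rewrite ler_wpM2r// ?ltW//; lra.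
  rewrite mulrC -ler_pdivlMr//; apply: ltW; near: n.
  exact: (near_infty_natSinv_lt (PosNum (divr_gt0 e0 K1))).
move: cvgf; under eq_fun do rewrite f_r; move=> cvgf.
exact: cvg_unique cvgf cr.
Unshelve. all: by end_near.
Qed.

End FTC.

(** * Quantile coordinates *)

Section UnitInterval.
Variable R : realType.
Local Notation mu := (@lebesgue_measure R).

(** The Lebesgue measure of ]0, 1[, as a measure on the line. *)
Definition unit_leb : set (measurableTypeR R) -> \bar R :=
  mrestr mu (measurable_itv `]0%R, 1%R[).

HB.instance Definition _ := Measure.on unit_leb.

Lemma unit_leb_setT : unit_leb setT = 1%E.
Proof. by rewrite /unit_leb /mrestr setTI lebesgue_measure_itv/= lte_fin ltr01 oppr0 adde0. Qed.

HB.instance Definition _ :=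
  Measure_isProbability.Build _ _ _ unit_leb unit_leb_setT.

Definition unit_prob : probability (measurableTypeR R) R := unit_leb.

Local Notation P := unit_prob.

Lemma unit_prob_itv (a b : R) : 0 <= a -> a <= b -> b <= 1 -> P (`]a, b]%classic : set R) = (b - a)%:E.
Proof.
move=> a0 ab b1; rewrite /unit_prob/= /unit_leb /mrestr.
apply/eqP; rewrite eq_le; apply/andP; split.
  apply: (@le_trans _ _ (mu `]a, b])).
    by apply: le_measure; rewrite ?inE//; apply: measurableI.
  rewrite lebesgue_measure_itv/= lte_fin; case: ifPn => [_|].
    by rewrite EFinB.
  by rewrite -leNgt => ba; rewrite lee_fin subr_ge0.
apply: (@le_trans _ _ (mu `]a, b[)).
  rewrite lebesgue_measure_itv/= lte_fin; case: ifPn => [_|].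
    by rewrite EFinB.
  by rewrite -leNgt => ba; rewrite lee_fin subr_le0.
apply: le_measure; rewrite ?inE//; first by apply: measurableI.
by move=> x /=; rewrite !in_itv/= => xab; split; lra.
Qed.

Lemma unit_prob_unit : P (`]0%R, 1%R[%classic : set R) = 1%E.
Proof.
by rewrite /unit_prob/= /unit_leb /mrestr setIid lebesgue_measure_itv/= lte_fin ltr01 oppr0 adde0.
Qed.

Lemma unit_prob_countable (A : set R) : countable A -> P A = 0%E.
Proof.
move=> cA; apply: countable_lebesgue_measure0.
apply: sub_countable cA; apply: subset_card_le; exact: subIsetl.
Qed.

Lemma ae_unit (S : set R) : (forall m, 0 < m < 1 -> S m) -> {ae P, forall m, S m}.
Proof.
move=> h; exists (~` (`]0%R, 1%R[%classic : set R)); split.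
- exact: measurableC.
- by rewrite /unit_prob/= /unit_leb /mrestr setICl measure0.
- by move=> m /= Sm; rewrite in_itv/=; apply: contra_not Sm => /h.
Qed.

(** The superlevel sets of a monotone function are intervals. *)
Lemma measurable_unit_nd (f : R -> R) :
  (forall a b : R, 0 < a -> a <= b -> b < 1 -> f a <= f b) ->
  (forall m, ~~ (0 < m < 1) -> f m = 0) ->
  measurable_fun setT f.
Proof.
move=> fnd f0.
have -> : f = f \_ (`]0%R, 1%R[%classic : set R).
  apply/funext => m; rewrite patchE; case: ifPn => //.
  by rewrite notin_setE/= in_itv/= => /negP; exact: f0.
apply/(measurable_restrictT _ _).1; first exact: measurable_itv.
have mD : measurable (`]0%R, 1%R[%classic : set R) by exact: measurable_itv.
apply: (measurability (@RGenCInfty.G R)) => [|/= _ [_] [r] -> <-].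
  exact: RGenCInfty.measurableE.
apply: is_interval_measurable => s t /=.
rewrite !in_itv/= !andbT => -[s01 fs] [t01 ft] u /andP[su ut].
rewrite !in_itv/= andbT; split; first lra.
by apply: (le_trans fs); apply: fnd; lra.
Qed.

End UnitInterval.

Section Quantile.
Variables (R : realType) (rho : probability (measurableTypeR R) R).
Local Notation P := (@unit_prob R).

Definition dfun (x : R) : R := fine (rho (`]-oo, x]%classic : set R)).

Lemma dfun_nd x y : x <= y -> dfun x <= dfun y.
Proof.
move=> xy; rewrite fine_le ?fin_num_measure// le_measure ?inE//.
exact: subitvPr.
Qed.

Let idTR : measurableTypeR R -> R := idfun.

#[local] HB.instance Definition _ :=
  @isMeasurableFun.Build _ _ _ _ idTR (@measurable_id _ _ setT).

Lemma dfunE x : (dfun x)%:E = cdf (idTR : {RV rho >-> R}) x.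
Proof. by rewrite /dfun fineK ?fin_num_measure. Qed.

Lemma dfun_right x m : (forall y, x < y -> m <= dfun y) -> m <= dfun x.
Proof.
move=> h; rewrite -lee_fin dfunE.
have c := @cdf_right_continuous _ _ R rho (idTR : {RV rho >-> R}) x.
apply: (cvge_to_ge c); near=> y; rewrite -dfunE lee_fin; apply: h.
by near: y; exact: nbhs_right_gt.
Unshelve. all: by end_near.
Qed.

Lemma dfun_y m : m < 1 -> exists x, m < dfun x.
Proof.
move=> m1; have /fine_cvg c := @cvg_cdfy1 _ _ R rho (idTR : {RV rho >-> R}).
have /(cvgr_gt (fine 1%E)) := c => /(_ _ m1) /filter_ex[x xm].
by exists x; exact: xm.
Qed.

Lemma dfun_Ny m : 0 < m -> exists x, dfun x < m.
Proof.
move=> m0; have /fine_cvg c := @cvg_cdfNy0 _ _ R rho (idTR : {RV rho >-> R}).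
have /(cvgr_lt (fine 0%E)) := c => /(_ _ m0) /filter_ex[x xm].
by exists x; exact: xm.
Qed.

Definition quantile (m : R) : R :=
  if 0 < m < 1 then inf [set x | m <= dfun x] else 0.

(** The Galois connection between the quantile function and the distribution
    function, which characterizes the former. *)
Lemma quantileP m x : 0 < m < 1 -> (quantile m <= x) <-> (m <= dfun x).
Proof.
move=> m01; rewrite /quantile m01; set S := [set x | m <= dfun x].
have /andP[m0 m1] := m01.
have hS : has_inf S.
  split; first by have [y ym] := dfun_y m1; exists y; exact: ltW.
  have [y ym] := dfun_Ny m0; exists y => z mz; rewrite leNgt; apply/negP => zy.
  by have := dfun_nd (ltW zy); have : m <= dfun z := mz; lra.
split => [Sx|mx]; last by apply: ge_inf => //; exact: hS.2.
apply: dfun_right => y xy.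
have yS : 0 < y - inf S by lra.
have [z mz zy] := inf_adherent yS hS.
by apply: (@le_trans _ _ (dfun z) _ _ mz); apply: dfun_nd; lra.
Qed.

Lemma quantile_nd a b : 0 < a -> a <= b -> b < 1 -> quantile a <= quantile b.
Proof.
move=> a0 ab b1; apply/quantileP; first lra.
by apply: (le_trans ab); apply/quantileP; [lra|].
Qed.

Lemma measurable_quantile : measurable_fun setT quantile.
Proof.
apply: measurable_unit_nd; first exact: quantile_nd.
by move=> m; rewrite /quantile => /negbTE ->.
Qed.

Definition quantile_rv : measurableTypeR R -> measurableTypeR R := quantile.

HB.instance Definition _ := @isMeasurableFun.Build _ _
  (measurableTypeR R) (measurableTypeR R) quantile_rv measurable_quantile.

(** Both measures give ]a, b] the mass F b - F a, where F is the distribution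
    function. *)
Lemma distribution_quantile (A : set (measurableTypeR R)) : measurable A ->
  distribution P quantile_rv A = rho A.
Proof.
move=> mA; pose nu := distribution P quantile_rv.
have d01 x : 0 <= dfun x <= 1.
  by rewrite -!lee_fin /dfun fineK ?fin_num_measure// measure_ge0 probability_le1.
have nuE (a b : R) : a <= b -> nu `]a, b]%classic = (dfun b - dfun a)%:E.
  move=> ab; transitivity (P (`]dfun a, dfun b]%classic : set R)).
    rewrite /nu /distribution /pushforward/= /unit_prob/= /unit_leb /mrestr; congr (lebesgue_measure _).
    apply/seteqP; split => m /=; rewrite /quantile_rv !in_itv/= => -[mab m01]; split => //.
      apply/andP; split.
        by rewrite ltNge; apply/negP => /(quantileP _ m01); lra.
      by apply/(quantileP _ m01); lra.
    apply/andP; split.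
      by rewrite ltNge; apply/negP => /(quantileP _ m01); lra.
    by apply/(quantileP _ m01); lra.
  apply: unit_prob_itv; [have := d01 a; lra|exact: dfun_nd|have := d01 b; lra].
have rhoE (a b : R) : a <= b -> rho `]a, b]%classic = (dfun b - dfun a)%:E.
  move=> ab; rewrite EFinB /dfun !fineK ?fin_num_measure//.
  have -> : `]a, b]%classic = `]-oo, b] `\` `]-oo, a] :> set R.
    by apply/seteqP; split => x /=; rewrite !in_itv/=; [move=> ?; split => //; lra|move=> [? /negP]; lra].
  rewrite measureD ?setIidr//; first exact: subset_itvl.
  by rewrite ltey_eq fin_num_measure.
apply: (@measure_unique _ R (measurableTypeR R) (@ocitv R) (fun n => `](- n%:R), n%:R]%classic) _ _ _ _ (distribution P quantile_rv) rho) => //.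
- exact: ocitvI.
- by move=> i; exact: is_ocitv.
- rewrite -subTset => x _; exists (Num.truncn `|x|).+1 => //=; rewrite in_itv/=.
  have := truncnS_gt `|x|; rewrite ltr_norml => /andP[h1 h2].
  by rewrite h1 ltW.
- move=> I [[a b] /= _ <-]; have [ab|ba] := leP a b; first by rewrite rhoE//; exact: nuE.
  by rewrite set_itv_ge ?measure0// bnd_simp -leNgt ltW.
- by move=> k; rewrite ltey_eq fin_num_measure.
Qed.

Lemma ge0_integral_quantile (f : measurableTypeR R -> \bar R) :
  measurable_fun setT f -> (forall x, 0 <= f x)%E ->
  (\int[rho]_x f x = \int[P]_m f (quantile m))%E.
Proof.
move=> mf f0; rewrite -(@ge0_integral_distribution _ _ _ _ _ P quantile_rv)//.
apply: eq_measure_integral => A mA _; exact/esym/distribution_quantile.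
Qed.

Lemma integral_quantile (f : measurableTypeR R -> \bar R) :
  measurable_fun setT f -> P.-integrable setT (f \o quantile) ->
  (\int[rho]_x f x = \int[P]_m f (quantile m))%E.
Proof.
move=> mf fi; rewrite -(@integral_distribution _ _ _ _ _ P quantile_rv)//.
apply: eq_measure_integral => A mA _; exact/esym/distribution_quantile.
Qed.

End Quantile.

(** * Functions of the mass coordinate *)

Section PInt.
Variable R : realType.
Local Notation P := (@unit_prob R).

Lemma integrable_cst_unit (A : set (measurableTypeR R)) (k : R) : measurable A ->
  P.-integrable A (EFin \o cst k).
Proof. exact: finite_measure_integrable_cst. Qed.

Lemma Rintegral_itv_bounds (f : R -> R) (a b lo hi : R) :
  0 <= a -> a <= b -> b <= 1 ->
  P.-integrable `]a, b] (EFin \o f) ->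
  (forall x, a < x <= b -> lo <= f x <= hi) ->
  lo * (b - a) <= \int[P]_(x in `]a, b]) f x <= hi * (b - a).
Proof.
move=> a0 ab b1 fi fb.
have cE (k : R) : \int[P]_(x in `]a, b]) k = k * (b - a).
  by rewrite Rintegral_cst//= unit_prob_itv.
apply/andP; split; rewrite -cE; apply: le_Rintegral => //.
- exact: integrable_cst_unit.
- by move=> x /=; rewrite in_itv/= => /fb /andP[].
- exact: integrable_cst_unit.
- by move=> x /=; rewrite in_itv/= => /fb /andP[].
Qed.

Lemma Rintegral_left_split (f : R -> R) (a b : R) : a <= b ->
  P.-integrable (`]-oo, b]%classic : set R) (EFin \o f) ->
  \int[P]_(x in `]-oo, b]) f x = \int[P]_(x in `]-oo, a]) f x + \int[P]_(x in `]a, b]) f x.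
Proof.
move=> ab fi.
have E : `]-oo, b]%classic = `]-oo, a] `|` `]a, b] :> set R.
  by apply/seteqP; split => x /=; rewrite !in_itv/=; [case: (leP x a); lra|lra].
rewrite [in LHS]E Rintegral_setU//; first by rewrite -E.
by apply/disj_setPS => x /=; rewrite !in_itv/=; lra.
Qed.

Lemma Rintegral_right_split (f : R -> R) (a b : R) : a <= b ->
  P.-integrable (`]a, +oo[%classic : set R) (EFin \o f) ->
  \int[P]_(x in `]a, +oo[) f x = \int[P]_(x in `]a, b]) f x + \int[P]_(x in `]b, +oo[) f x.
Proof.
move=> ab fi.
have E : `]a, +oo[%classic = `]a, b] `|` `]b, +oo[ :> set R.
  by apply/seteqP; split => x /=; rewrite !in_itv/= !andbT; [case: (leP x b); lra|lra].
rewrite [in LHS]E Rintegral_setU//; first by rewrite -E.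
by apply/disj_setPS => x /=; rewrite !in_itv/= !andbT; lra.
Qed.

(** At a discontinuity the function jumps over some rational, and a monotone
    function jumps over a given rational at one point at most. *)
Lemma countable_discontinuities (f : R -> R) :
  (forall a b : R, 0 < a -> a <= b -> b < 1 -> f a <= f b) ->
  countable [set m : R | 0 < m < 1 /\ ~ {for m, continuous f}].
Proof.
move=> fnd.
pose D (r : rat) := [set m : R | [/\ 0 < m < 1,
   forall b, m < b < 1 -> ratr r < f b & forall b, 0 < b < m -> f b < ratr r]].
apply: (@sub_countable _ _ _ (\bigcup_r D r)).
  apply: subset_card_le => m [m01 nc].
  suff [r hr] : exists r : rat, (f m < ratr r /\ forall b, m < b < 1 -> ratr r < f b) \/
      (ratr r < f m /\ forall b, 0 < b < m -> f b < ratr r).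
    exists r => //; case: hr => [[fr hb]|[fr hb]]; split => //.
      by move=> b bm; apply: le_lt_trans fr; apply: fnd; lra.
    by move=> b bm; apply: (lt_le_trans fr); apply: fnd; lra.
  apply: contrapT => hr; apply: nc.
  apply/cvgrPdist_lt => e e0.
  have [b bm fb] : exists2 b, m < b < 1 & f b < f m + e.
    have : f m < f m + e by lra.
    move=> /rat_in_itvoo[r]; rewrite in_itv/= => /andP[r1 r2].
    apply: contrapT => hn; apply: hr; exists r; left; split => // b bm.
    apply: (lt_le_trans r2); rewrite leNgt; apply/negP => fb; apply: hn.
    by exists b.
  have [a am fa] : exists2 a, 0 < a < m & f m - e < f a.
    have : f m - e < f m by lra.
    move=> /rat_in_itvoo[r]; rewrite in_itv/= => /andP[r1 r2].
    apply: contrapT => hn; apply: hr; exists r; right; split => // a am.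
    apply: le_lt_trans r1; rewrite leNgt; apply/negP => fa; apply: hn.
    by exists a.
  exists (Num.min (b - m) (m - a)) => /=; first by rewrite lt_min; lra.
  move=> x /=; rewrite lt_min !ltr_distl => xm.
  have h1 : f a <= f x by apply: fnd; lra.
  have h2 : f x <= f b by apply: fnd; lra.
  lra.
apply: bigcup_countable => [|r _]; first exact: countableP.
apply: finite_set_countable.
apply: (@sub_finite_set _ _ [set (if pselect (exists m, D r m) is left h then sval (cid h) else 0)]) => //.
move=> m Dm /=; case: pselect => [h|]; last by move=> h; exfalso; apply: h; exists m.
case: (cid h) => n Dn /=; have [m01 m1 m2] := Dm; have [n01 n1 n2] := Dn.
have [mn|nm|//] := ltgtP m n.
- have := m1 ((m + n) / 2) ltac:(lra); have := n2 ((m + n) / 2) ltac:(lra); lra.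
- have := n1 ((m + n) / 2) ltac:(lra); have := m2 ((m + n) / 2) ltac:(lra); lra.
Qed.

Lemma ae_continuous_nd (f : R -> R) :
  (forall a b : R, 0 < a -> a <= b -> b < 1 -> f a <= f b) ->
  {ae P, forall m, 0 < m < 1 /\ {for m, continuous f}}.
Proof.
move=> fnd.
have [S [mS S0 hS]] : {ae P, forall m : R, 0 < m < 1} by exact: ae_unit.
have cD := countable_discontinuities fnd.
have mD : measurable ([set m : R | 0 < m < 1 /\ ~ {for m, continuous f}] : set (measurableTypeR R)).
  by apply: countable_measurable cD => m; exact: measurable_set1.
exists (S `|` [set m : R | 0 < m < 1 /\ ~ {for m, continuous f}]); split.
- exact: measurableU.
- by rewrite null_set_setU//; exact: (unit_prob_countable cD).
- move=> m /= hm; have [m01|m01] := pselect (0 < m < 1); last by left; apply: hS.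
  by right; split => // h; apply: hm.
Qed.

End PInt.

Section L2.
Variable R : realType.
Local Notation P := (@unit_prob R).

Definition inL2 (f : R -> R) : Prop :=
  measurable_fun setT f /\ (\int[P]_m (f m ^+ 2)%:E < +oo)%E.

Lemma inL2_sqr f : inL2 f -> P.-integrable setT (EFin \o (fun m => f m ^+ 2)).
Proof.
move=> [mf f2]; apply/integrableP; split.
  by apply/measurable_EFinP; apply: measurable_funX.
by under eq_integral do rewrite /= ger0_norm ?sqr_ge0//.
Qed.

Lemma inL2_mul f g : inL2 f -> inL2 g -> P.-integrable setT (EFin \o (fun m => f m * g m)).
Proof.
move=> hf hg; have i1 := @integrableD _ _ _ P _ measurableT _ _ (inL2_sqr hf) (inL2_sqr hg).
apply: le_integrable i1 => //.
- by apply/measurable_EFinP; apply: measurable_funM; [exact: hf.1|exact: hg.1].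
- move=> m _ /=; rewrite lee_fin [leRHS]ger0_norm ?addr_ge0 ?sqr_ge0//.
  have := sqr_ge0 (f m - g m); have := sqr_ge0 (f m + g m).
  have := sqr_ge0 (f m); have := sqr_ge0 (g m).
  by rewrite ler_norml !expr2; lra.
Qed.

Lemma inL2_cst k : inL2 (fun=> k).
Proof.
split => //; rewrite -[ltLHS]fineK ?ltry//.
exact: integrable_fin_num (integrable_cst_unit (k ^+ 2) measurableT).
Qed.

Lemma inL2_integrable f : inL2 f -> P.-integrable setT (EFin \o f).
Proof.
move=> hf; have := inL2_mul hf (inL2_cst 1).
by under eq_fun do rewrite mulr1.
Qed.

End L2.

(** * The potentials of the initial data *)

Section Build.
Variables (R : realType) (rho0 : probability (measurableTypeR R) R) (v0 : R -> R).
Hypothesis v0_cont : continuous v0.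
Hypothesis v0_L2 : (\int[rho0]_x (v0 x ^+ 2)%:E < +oo)%E.
Local Notation P := (@unit_prob R).
Local Notation q := (quantile rho0).

Definition vel0 (m : R) : R := v0 (q m).
Local Notation c := vel0.

Lemma measurable_vel0 : measurable_fun setT c.
Proof.
apply: (@measurableT_comp _ _ _ _ _ _ v0); last exact: measurable_quantile.
exact: continuous_measurable_fun.
Qed.

Lemma vel0_inL2 : inL2 c.
Proof.
split; first exact: measurable_vel0.
rewrite -(@ge0_integral_quantile _ rho0 (fun x => (v0 x ^+ 2)%:E))//.
- apply/measurable_EFinP; apply: measurable_funX.
  exact: continuous_measurable_fun.
- by move=> x; rewrite lee_fin sqr_ge0.
Qed.

Let vel0_sqr_integrable : P.-integrable setT (EFin \o (fun m => c m ^+ 2)).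
Proof. exact: inL2_sqr vel0_inL2. Qed.

Let vel0_integrable : P.-integrable setT (EFin \o c).
Proof. exact: inL2_integrable vel0_inL2. Qed.

Let cI (A : set (measurableTypeR R)) : measurable A -> P.-integrable A (EFin \o c).
Proof. by move=> mA; apply: (integrableS measurableT) vel0_integrable. Qed.

(** The quantile function need not be integrable near 0 or near 1.  Its positive
    part is bounded on the left of any point of ]0, 1[ and its negative part on
    the right, so that the primitive potU is assembled from these two. *)
Definition qpos (m : R) : R := Num.max (q m) 0.
Definition qneg (m : R) : R := Num.max (- q m) 0.

Lemma qpos_qneg m : q m = qpos m - qneg m.
Proof. by rewrite /qpos /qneg; case: (leP (q m) 0); case: (leP (- q m) 0); lra. Qed.

Lemma qpos_integrable (b : R) : 0 < b < 1 ->
  P.-integrable (`]-oo, b]%classic : set R) (EFin \o qpos).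
Proof.
move=> b01.
apply: measurable_bounded_integrable => //.
- by rewrite ltey_eq fin_num_measure.
- apply: measurable_maxr => //; apply: measurable_funTS; exact: measurable_quantile.
- exists (qpos b); split; first exact: num_real.
  move=> y qy x /=; rewrite in_itv/= => xb; apply: le_trans (ltW qy).
  rewrite ger0_norm; last by rewrite /qpos le_max lexx orbT.
  have [x01|x01] := boolP (0 < x < 1).
    by rewrite /qpos ge_max !le_max lexx orbT andbT quantile_nd//; lra.
  by rewrite {1}/qpos /quantile (negbTE x01) maxxx /qpos le_max lexx orbT.
Qed.

Lemma qneg_integrable (b : R) : 0 < b < 1 ->
  P.-integrable (`]b, +oo[%classic : set R) (EFin \o qneg).
Proof.
move=> b01.
apply: measurable_bounded_integrable => //.
- by rewrite ltey_eq fin_num_measure.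
- apply: measurable_maxr => //; apply: measurable_funTS; apply: measurable_funN; exact: measurable_quantile.
- exists (qneg b); split; first exact: num_real.
  move=> y qy x /=; rewrite in_itv/= andbT => xb; apply: le_trans (ltW qy).
  rewrite ger0_norm; last by rewrite /qneg le_max lexx orbT.
  have [x01|x01] := boolP (0 < x < 1).
    by rewrite /qneg ge_max !le_max lexx orbT andbT lerN2 quantile_nd//; lra.
  by rewrite {1}/qneg /quantile (negbTE x01) oppr0 maxxx /qneg le_max lexx orbT.
Qed.

Definition potU (m : R) : R :=
  \int[P]_(x in `]-oo, m]) qpos x + \int[P]_(x in `]m, +oo[) qneg x.

Lemma potU_incr a b : 0 < a -> a <= b -> b < 1 ->
  q a * (b - a) <= potU b - potU a <= q b * (b - a).
Proof.
move=> a0 ab b1; have a01 : 0 < a < 1 by lra. have b01 : 0 < b < 1 by lra.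
have i1 := qpos_integrable b01; have i2 := qneg_integrable a01.
rewrite /potU (Rintegral_left_split ab i1) (Rintegral_right_split ab i2).
have j1 : P.-integrable (`]a, b]%classic : set R) (EFin \o qpos).
  by apply: integrableS i1 => //; exact: subset_itvr.
have j2 : P.-integrable (`]a, b]%classic : set R) (EFin \o qneg).
  by apply: integrableS i2 => //; exact: subset_itvl.
have nd x : a < x <= b -> q a <= q x <= q b.
  by move=> xab; rewrite !quantile_nd//; lra.
have h1 := @Rintegral_itv_bounds R qpos a b (qpos a) (qpos b) (ltW a0) ab (ltW b1) j1.
have h2 := @Rintegral_itv_bounds R qneg a b (qneg b) (qneg a) (ltW a0) ab (ltW b1) j2.
have {}h1 := h1 _; have {}h2 := h2 _.
have {}h1 := h1 ltac:(move=> x /nd; rewrite /qpos !ge_max !le_max lexx !orbT !andbT => /andP[-> ->]//).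
have {}h2 := h2 ltac:(move=> x /nd; rewrite /qneg !ge_max !le_max lexx !orbT !andbT !lerN2 => /andP[-> ->]//).
rewrite (qpos_qneg a) (qpos_qneg b); lra.
Qed.

Lemma potU_sub k m : 0 < k < 1 -> 0 < m < 1 -> potU k + q k * (m - k) <= potU m.
Proof.
move=> k01 m01; have [km|mk] := leP k m.
- have := @potU_incr k m ltac:(lra) km ltac:(lra); lra.
- have := @potU_incr m k ltac:(lra) (ltW mk) ltac:(lra); lra.
Qed.

Definition potV (m : R) : R := \int[P]_(x in `]-oo, m]) c x.

Lemma potV_incr a b : a <= b -> potV b - potV a = \int[P]_(x in `]a, b]) c x.
Proof.
by move=> ab; rewrite /potV (Rintegral_left_split ab) ?cI//; ring.
Qed.

Definition potV_max : R := \int[P]_x `|c x|.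

Lemma potV_bnd m : `|potV m| <= potV_max.
Proof.
rewrite /potV /potV_max; apply: le_trans (le_normr_Rintegral _ _) _ => //; first exact: cI.
have i1 : P.-integrable setT (EFin \o (fun x => `|c x|)).
  exact: (@integrable_norm _ _ _ P _ c vel0_integrable).
rewrite /Rintegral fine_le//.
- by apply: integrable_fin_num => //; apply: integrableS i1.
- exact: integrable_fin_num.
- apply: ge0_subset_integral => //.
  by apply/measurable_EFinP; apply: measurableT_comp => //; exact: measurable_vel0.
Qed.

(** An L2 function has a uniformly continuous primitive: |c| <= N / 2 + c^2 / (2 N),
    with N large and then b - a small. *)
Lemma potV_uc (e : R) : 0 < e -> exists2 d : R, 0 < d &
    forall a b : R, 0 <= a <= 1 -> 0 <= b <= 1 -> `|a - b| < d ->
      `|potV a - potV b| < e.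
Proof.
move=> e0; pose S := \int[P]_x (c x ^+ 2).
have S0 : 0 <= S by apply: Rintegral_ge0 => x _; exact: sqr_ge0.
pose N := (S + 1) / e.
have N0 : 0 < N by rewrite /N divr_gt0//; lra.
exists (e / N); first exact: divr_gt0.
have main a b : 0 <= a -> a <= b -> b <= 1 -> b - a < e / N -> `|potV b - potV a| < e.
  move=> a0 ab b1 bad; rewrite potV_incr//.
  have ic : P.-integrable (`]a, b]%classic : set R) (EFin \o c) by exact: cI.
  apply: le_lt_trans (le_normr_Rintegral _ ic) _ => //.
  have iS : P.-integrable (`]a, b]%classic : set R) (EFin \o (fun m => c m ^+ 2)).
    exact: (integrableS measurableT) vel0_sqr_integrable.
  have iS2 : P.-integrable (`]a, b]%classic : set R) (EFin \o (fun m => (2 * N)^-1 * c m ^+ 2)).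
    exact: (@integrableZl _ _ _ P _ (measurable_itv _) _ _ iS).
  have icst : P.-integrable (`]a, b]%classic : set R) (EFin \o cst (N / 2)).
    exact: integrable_cst_unit.
  apply: (@le_lt_trans _ _ (\int[P]_(x in `]a, b]) (N / 2 + (2 * N)^-1 * c x ^+ 2))).
    apply: le_Rintegral => //.
    - exact: (@integrable_norm _ _ _ P _ c).
    - exact: (@integrableD _ _ _ P _ (measurable_itv _) _ _ icst iS2).
    - move=> x _; rewrite -(ler_pM2l (_ : 0 < 2 * N)); last lra.
      rewrite mulrDr mulVKf; last lra.
      have := sqr_ge0 (`|c x| - N); rewrite -[c x ^+ 2]real_normK ?num_real// !expr2; lra.
  have cE : \int[P]_(x in `]a, b]) (N / 2) = N / 2 * (b - a).
    by rewrite Rintegral_cst//= unit_prob_itv.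
  rewrite RintegralD// cE RintegralZl//.
  have hS : \int[P]_(x in `]a, b]) (c x ^+ 2) <= S.
    rewrite /S /Rintegral fine_le//.
    - by apply: integrable_fin_num.
    - by apply: integrable_fin_num => //; exact: vel0_sqr_integrable.
    - apply: ge0_subset_integral => //; last by move=> x _; rewrite lee_fin sqr_ge0.
      by apply/measurable_EFinP; apply: measurable_funX; exact: measurable_vel0.
  have h1 : N / 2 * (b - a) < e / 2.
    by move: bad; rewrite ltr_pdivlMr//; lra.
  have h2 : (2 * N)^-1 * \int[P]_(x in `]a, b]) (c x ^+ 2) <= e / 2.
    rewrite mulrC ler_pdivrMr; last lra.
    have -> : e / 2 * (2 * N) = S + 1 by rewrite /N; field; lra.
    lra.
  lra.
move=> a b a01 b01; have [ab|ba] := leP a b.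
- by rewrite distrC ger0_norm ?subr_ge0// => h; rewrite distrC; apply: main; lra.
- by rewrite ger0_norm ?subr_ge0 ?ltW// => h; apply: main; lra.
Qed.

Lemma vel0_loc_bnd l h : exists2 K : R, 0 <= K & forall x, l <= q x <= h -> `|c x| <= K.
Proof.
have [lh|hl] := leP l h; last by exists 0 => // x; lra.
have cv0 : {within `[l, h], continuous (fun x => `|v0 x|)}.
  apply: continuous_subspaceT => x; apply: continuous_comp; first exact: v0_cont.
  exact: norm_continuous.
have [k _ hk] := EVT_max lh cv0.
by exists (`|v0 k|) => // x lxh; apply: hk; rewrite in_itv.
Qed.

(** Near m the velocity c = v0 (q) is bounded, because q takes values in a
    compact interval there and v0 is continuous.  If a or b is far from m, then
    b - a is bounded below and a bound on potV suffices. *)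
Lemma potV_lip m : 0 < m < 1 -> exists2 K : R, 0 <= K &
  forall a b : R, 0 < a < m -> m <= b < 1 -> `|potV b - potV a| <= K * (b - a).
Proof.
move=> m01.
have [M M0 hM] := vel0_loc_bnd (q (m / 2)) (q ((m + 1) / 2)).
pose d := Num.min (m / 2) ((1 - m) / 2).
have d0 : 0 < d by rewrite lt_min; lra.
have d1 : d <= m / 2 by rewrite ge_min lexx.
have d2 : d <= (1 - m) / 2 by rewrite ge_min lexx orbT.
have B0 : 0 <= potV_max by apply: le_trans (potV_bnd 0).
exists (M + 2 * potV_max / d); first by rewrite addr_ge0// divr_ge0//; lra.
move=> a b am bm; have [/andP[ha hb]|far] := boolP ((m / 2 <= a) && (b <= (m + 1) / 2)).
  rewrite potV_incr; last lra.
  apply: (@le_trans _ _ (M * (b - a))); last first.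
    by rewrite ler_wpM2r ?lerDl ?divr_ge0//; lra.
  have := @Rintegral_itv_bounds R c a b (- M) M ltac:(lra) ltac:(lra) ltac:(lra) (cI (measurable_itv _)).
  rewrite ler_norml mulNr; apply => x xab; rewrite -ler_norml; apply: hM.
  by rewrite !quantile_nd//; lra.
have bad : d <= b - a.
  by move: far; rewrite negb_and -!ltNge => /orP[]; lra.
apply: (@le_trans _ _ (2 * potV_max)).
  by apply: le_trans (ler_normB _ _) _; have := potV_bnd a; have := potV_bnd b; lra.
apply: (@le_trans _ _ (2 * potV_max / d * (b - a))).
  by rewrite mulrAC ler_pdivlMr// ler_wpM2l//; lra.
by rewrite ler_wpM2r//; lra.
Qed.

(** The primitive of a function is differentiable where this function is
    continuous, and c = v0 (q) is continuous where q is. *)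
Lemma potV_diff m : 0 < m < 1 -> {for m, continuous q} ->
  forall e : R, 0 < e -> exists2 d : R, 0 < d &
  forall b : R, `|b - m| < d -> `|potV b - potV m - c m * (b - m)| <= e * `|b - m|.
Proof.
move=> m01 qm e e0.
have cm : {for m, continuous c}.
  by apply: continuous_comp; [exact: qm|exact: v0_cont].
have [d' d'0 hd] := continuous_near cm e0.
pose d := Num.min d' (Num.min (m / 2) ((1 - m) / 2)).
have d0 : 0 < d by rewrite !lt_min d'0; lra.
have d1 : d <= d' by rewrite ge_min lexx.
have d2 : d <= m / 2 by rewrite !ge_min lexx orbT.
have d3 : d <= (1 - m) / 2 by rewrite !ge_min lexx !orbT.
exists d => // b bm.
have cx x : `|x - m| < d -> c m - e <= c x <= c m + e.
  by move=> xm; have := hd x ltac:(lra); rewrite ltr_norml; lra.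
have [mb|bm'] := leP m b.
- have bmE : `|b - m| = b - m by rewrite ger0_norm ?subr_ge0.
  rewrite potV_incr// bmE; rewrite bmE in bm.
  have := @Rintegral_itv_bounds R c m b (c m - e) (c m + e) ltac:(lra) mb ltac:(lra) (cI (measurable_itv _)).
  move=> /(_ _)h; have {}h := h ltac:(move=> x xmb; apply: cx; rewrite ltr_norml; lra).
  by rewrite ler_norml; lra.
- have -> : potV b - potV m = - (potV m - potV b) by ring.
  have bmE : `|b - m| = - (b - m) by rewrite ltr0_norm ?subr_lt0.
  rewrite (potV_incr (ltW bm')) bmE; rewrite bmE in bm.
  have := @Rintegral_itv_bounds R c b m (c m - e) (c m + e) ltac:(lra) (ltW bm') ltac:(lra) (cI (measurable_itv _)).
  move=> /(_ _)h; have {}h := h ltac:(move=> x xmb; apply: cx; rewrite ltr_norml; lra).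
  by rewrite ler_norml; lra.
Qed.

Definition sticky_data : flow_data R :=
  @FlowData R q c potU potV potV_max (@quantile_nd _ rho0) potU_sub potV_bnd potV_uc
    potV_lip potV_diff.

End Build.

(** * Joint measurability of the flow *)

Lemma measurable_invr (R : realType) : measurable_fun setT (fun x : R => x^-1).
Proof.
have E : setT = (`]-oo, 0%R[ `|` `]0%R, +oo[) `|` [set 0%R] :> set R.
  apply/seteqP; split => // x _ /=; rewrite !in_itv/= andbT.
  by case: (ltgtP x 0); [left; left|left; right|right].
rewrite E; apply/measurable_funU => //; first exact: measurableU.
split; last exact: measurable_fun_set1.
apply/measurable_funU => //; split; apply: open_continuous_measurable_fun;
  rewrite ?openE//.
- exact: interval_open.
- by move=> x; rewrite inE/= in_itv/= => x0; apply: inv_continuous; rewrite lt_eqF.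
- exact: interval_open.
- by move=> x; rewrite inE/= in_itv/= andbT => x0; apply: inv_continuous; rewrite gt_eqF.
Qed.

Section JointMeasurability.
Variables (R : realType) (p : flow_data R).
Hypothesis mq : measurable_fun setT (initpos p).
Local Notation X := (position p).
Local Notation alpha := (alpha p).
Local Notation beta := (beta p).
Local Notation plane := (measurableTypeR R * measurableTypeR R)%type.

Lemma measurable_position_time m : 0 < m < 1 -> measurable_fun setT (X^~ m).
Proof.
move=> m01; have [K _ hK] := position_lip p m01.
by apply: continuous_measurable_fun; exact: (lipschitz_cts hK).
Qed.

Lemma measurable_le_set s : 0 < s < 1 ->
  measurable [set z : plane | X z.2 s <= z.1].
Proof.
move=> s01.
have h : measurable_fun setT (fun z : plane => X z.2 s <= z.1).
  apply: measurable_fun_ler => //.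
  by apply: (measurableT_comp (measurable_position_time s01)).
by have := h measurableT [set true] I; rewrite setTI.
Qed.

Lemma measurable_lt_set s : 0 < s < 1 ->
  measurable [set z : plane | X z.2 s < z.1].
Proof.
move=> s01.
have h : measurable_fun setT (fun z : plane => X z.2 s < z.1).
  apply: measurable_fun_ltr => //.
  by apply: (measurableT_comp (measurable_position_time s01)).
by have := h measurableT [set true] I; rewrite setTI.
Qed.

(** beta t x exceeds r if and only if position t s <= x for some rational label
    s > r, and position is continuous in time.  The same reason applies to alpha
    and to the flow. *)
Lemma measurable_beta :
  measurable_fun setT (fun z : plane => beta z.2 z.1 : measurableTypeR R).
Proof.
apply: (measurability (@RGenOInfty.G R)) => [|/= _ [_] [r] -> <-].
  exact: RGenOInfty.measurableE.
rewrite setTI.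
have [r0|r0] := ltP r 0.
  rewrite (_ : _ @^-1` _ = setT)//; apply/seteqP; split => // z _ /=.
  by rewrite in_itv/= andbT; have := beta01 p z.2 z.1; lra.
have -> : (fun z : plane => beta z.2 z.1) @^-1` `]r, +oo[ =
   \bigcup_(s : rat) (if r < (ratr s : R) < 1 then [set z : plane | X z.2 (ratr s) <= z.1] else set0).
  apply/seteqP; split => z /=; rewrite in_itv/= andbT.
    move=> /rat_in_itvoo[s]; rewrite in_itv/= => /andP[rs sb].
    have := beta01 p z.2 z.1 => b01.
    have s01 : 0 < (ratr s : R) < 1 by lra.
    exists s => //; rewrite ifT; last lra.
    by apply/betaP => //; exact: ltW.
  move=> [s _]; case: ifPn => // rs Xs.
  by have : ratr s <= beta z.2 z.1 by [apply/betaP => //; lra|]; lra.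
apply: bigcupT_measurable_rat => s; case: ifPn => // rs.
by apply: measurable_le_set; lra.
Qed.

Lemma measurable_alpha :
  measurable_fun setT (fun z : plane => alpha z.2 z.1 : measurableTypeR R).
Proof.
apply: (measurability (@RGenOInfty.G R)) => [|/= _ [_] [r] -> <-].
  exact: RGenOInfty.measurableE.
rewrite setTI.
have [r0|r0] := ltP r 0.
  rewrite (_ : _ @^-1` _ = setT)//; apply/seteqP; split => // z _ /=.
  by rewrite in_itv/= andbT; have := alpha01 p z.2 z.1; lra.
have -> : (fun z : plane => alpha z.2 z.1) @^-1` `]r, +oo[ =
   \bigcup_(s : rat) (if r < (ratr s : R) < 1 then [set z : plane | X z.2 (ratr s) < z.1] else set0).
  apply/seteqP; split => z /=; rewrite in_itv/= andbT.
    move=> /rat_in_itvoo[s]; rewrite in_itv/= => /andP[rs sb].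
    have := alpha01 p z.2 z.1 => b01.
    have s01 : 0 < (ratr s : R) < 1 by lra.
    exists s => //; rewrite ifT; last lra.
    exact: alpha_lt.
  move=> [s _]; case: ifPn => // rs Xs.
  by have : ratr s <= alpha z.2 z.1 by [apply: alpha_ge => //; lra|]; lra.
apply: bigcupT_measurable_rat => s; case: ifPn => // rs.
by apply: measurable_lt_set; lra.
Qed.

(** mom_uc gives the continuity of mom on [0, 1] only; this extension is
    continuous on the line, hence measurable. *)
Definition clampV (x : R) : R := mom p (Num.max 0 (Num.min 1 x)).

Lemma measurable_clampV : measurable_fun setT clampV.
Proof.
apply: continuous_measurable_fun => t.
apply/cvgrPdist_lt => e e0.
have [d d0 hd] := mom_uc p e0.
exists d => // s /= ts.
have cl (x : R) : 0 <= Num.max 0 (Num.min 1 x) <= 1.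
  by rewrite le_max lexx/= ge_max ler01/= ge_min lexx.
apply: hd => //; apply: le_lt_trans ts.
rewrite /Num.max /Num.min; do ! case: ifPn; rewrite -?leNgt => *;
  rewrite ler_norml; have := ler_norm (t - s); have := ler_norm (s - t);
  rewrite (distrC s t); lra.
Qed.

Lemma clampVE x : 0 <= x <= 1 -> clampV x = mom p x.
Proof.
by move=> /andP[x0 x1]; rewrite /clampV min_r// max_r.
Qed.

Lemma measurable_vel :
  measurable_fun setT (fun z : plane => vel p z.2 z.1 : measurableTypeR R).
Proof.
have ma := measurable_alpha; have mb := measurable_beta.
rewrite /vel; apply: measurable_fun_ifT.
- exact: measurable_fun_ltr.
- apply: (eq_measurable_fun (fun z : plane =>
    (clampV (beta z.2 z.1) - clampV (alpha z.2 z.1)) * (beta z.2 z.1 - alpha z.2 z.1)^-1)).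
    by move=> z _; rewrite !clampVE ?alpha01 ?beta01.
  apply: measurable_funM.
    by apply: measurable_funB; apply: measurableT_comp => //; exact: measurable_clampV.
  apply: (measurableT_comp (@measurable_invr R)); exact: measurable_funB.
- apply: measurable_funM.
    by apply: measurable_funB => //; apply: measurableT_comp.
  by apply: (measurableT_comp (@measurable_invr R)).
Qed.

Definition flow (t m : R) : R := if 0 < m < 1 then X t m else 0.

Local Notation Y := flow.

Lemma measurable_flow :
  measurable_fun setT (fun z : plane => Y z.2 z.1 : measurableTypeR R).
Proof.
pose D : set plane := (`]0%R, 1%R[%classic : set R) `*` setT.
have mD : measurable D by exact: measurableX.
apply: (measurability (@RGenOInfty.G R)) => [|/= _ [_] [r] -> <-].
  exact: RGenOInfty.measurableE.
rewrite setTI.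
have -> : (fun z : plane => Y z.2 z.1) @^-1` `]r, +oo[ =
   (D `&` \bigcup_(s : rat) (if 0 < (ratr s : R) < 1 then
       (`]ratr s, +oo[%classic : set R) `*` [set t : R | r < X t (ratr s)] else set0))
    `|` (~` D `&` [set _ | r < 0]).
  apply/seteqP; split => z /=; rewrite !in_itv/= !andbT /flow.
    case: ifPn => z01.
      move=> rX; left; split => //.
      apply: contrapT => hn.
      suff : X z.2 z.1 <= r by lra.
      apply: position_left => // n nz.
      rewrite leNgt; apply/negP => rXn; apply: hn.
      have : n < z.1 by lra.
      move=> /rat_in_itvoo[s]; rewrite in_itv/= => /andP[s1 s2].
      have s01 : 0 < (ratr s : R) < 1 by lra.
      exists s => //; rewrite s01/=; split; rewrite ?in_itv/= ?andbT//.
      by apply: (lt_le_trans rXn); apply: position_mono; lra.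
    by move=> r0; right; split => //; rewrite /D/= in_itv/= => -[h _]; move: z01; rewrite h.
  rewrite /D/= in_itv/= => -[[[z01 _] [s _]]|[nz r0]].
    rewrite z01; case: ifPn => // s01 [/=]; rewrite in_itv/= andbT => s1 s2.
    by apply: (lt_le_trans s2); apply: position_mono; lra.
  by rewrite ifN//; apply/negP => z01; apply: nz.
apply: measurableU.
  apply: measurableI => //; apply: bigcupT_measurable_rat => s; case: ifPn => // s01.
  apply: measurableX => //.
  rewrite (_ : [set t : R | r < X t (ratr s)] = X^~ (ratr s) @^-1` `]r, +oo[).
    by rewrite -[X in measurable X]setTI; exact: measurable_position_time.
  by apply/seteqP; split => t /=; rewrite in_itv/= andbT.
apply: measurableI; first exact: measurableC.
have [r0|r0] := ltP r 0.
  by rewrite (_ : [set _ | _] = setT)//; apply/seteqP; split.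
by rewrite (_ : [set _ | _] = set0)//; apply/seteqP; split.
Qed.

End JointMeasurability.

(** * The velocity as a conditional expectation *)

Section Blocks.
Variables (R : realType) (rho0 : probability (measurableTypeR R) R) (v0 : R -> R).
Hypothesis v0_cont : continuous v0.
Hypothesis v0_L2 : (\int[rho0]_x (v0 x ^+ 2)%:E < +oo)%E.
Local Notation P := (@unit_prob R).
Local Notation p := (sticky_data v0_cont v0_L2).
Local Notation c := (vel0 rho0 v0).
Local Notation X := (position p).
Local Notation alpha := (alpha p).
Local Notation beta := (beta p).
Local Notation Y := (flow p).
Local Notation vel0_inL2 := (vel0_inL2 v0_cont v0_L2).

Lemma measurable_flow_t t : measurable_fun setT (Y t).
Proof. exact: (measurable_fun_pair1 t (measurable_flow p)). Qed.

Definition flow_vel (t m : R) : R := vel p t (Y t m).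
Local Notation w := flow_vel.

Lemma measurable_flow_vel t : measurable_fun setT (w t).
Proof.
apply: (measurableT_comp (measurable_fun_pair1 t (measurable_vel _))) => //.
- exact: measurable_quantile.
- exact: measurable_flow_t.
Qed.

Lemma flow_velE t m : 0 < m < 1 -> w t m = vel p t (X t m).
Proof. by move=> m01; rewrite /flow_vel /flow m01. Qed.

Variables (t : R) (t0 : 0 < t).

Definition block m : set (measurableTypeR R) := [set n : R | 0 < n < 1 /\ X t n = X t m].

Lemma measurable_block m : measurable (block m).
Proof.
rewrite (_ : block m = (`]0%R, 1%R[%classic : set R) `&` Y t @^-1` [set X t m]).
  apply: measurableI => //; rewrite -[X in measurable X]setTI.
  by apply: (measurable_flow_t t).
apply/seteqP; split => n /=; rewrite in_itv/= /flow.
  by move=> [n01 nm]; rewrite n01.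
by move=> [n01]; rewrite n01.
Qed.

(** The particles at the position of m form an interval with end points alpha and
    beta, up to two points. *)
Lemma block_integral m g : 0 < m < 1 -> P.-integrable setT (EFin \o g) ->
  (\int[P]_(n in block m) (g n)%:E =
   \int[P]_(n in `]alpha t (X t m), beta t (X t m)]) (g n)%:E)%E.
Proof.
move=> m01 gi.
pose N : set (measurableTypeR R) := [set alpha t (X t m)] `|` ~` `]0%R, 1%R[%classic.
have mN : measurable N by apply: measurableU => //; exact: measurableC.
have N0 : P N = 0%E.
  have h1 : P [set alpha t (X t m)] = 0%E by exact: unit_prob_countable.
  have h2 : P (~` (`]0%R, 1%R[%classic : set R)) = 0%E.
    by rewrite /unit_prob/= /unit_leb /mrestr setICl measure0.
  by rewrite /N null_set_setU//; exact: measurableC.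
rewrite (negligible_integral mN _ _ N0); last 2 first.
- exact: measurable_block.
- by apply: (integrableS measurableT) gi => //; exact: measurable_block.
rewrite [RHS](negligible_integral mN _ _ N0)//; last first.
  exact: (integrableS measurableT) gi.
congr (integral _ _ _); apply/seteqP; split => n /=; rewrite !in_itv/=.
  move=> [[n01 nm] hn]; split => //.
  have na : n <> alpha t (X t m) by move=> h; apply: hn; left.
  have := alpha_le p t n01; rewrite nm; have := beta_ge p t n01; rewrite nm => h1 h2.
  by rewrite h1 andbT lt_neqAle h2 andbT eq_sym; apply/eqP.
move=> [nab hn]; split => //.
have n01 : 0 < n < 1 by apply: contrapT => h; apply: hn; right.
split => //; apply/eqP; rewrite eq_le; apply/andP; split.
  by apply/betaP => //; lra.
rewrite leNgt; apply/negP => h; have := alpha_ge n01 h; lra.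
Qed.

Lemma block_vel m : 0 < m < 1 -> ~~ single p t m ->
  potV rho0 v0 (beta t (X t m)) - potV rho0 v0 (alpha t (X t m)) =
  w t m * (beta t (X t m) - alpha t (X t m)).
Proof.
move=> m01; rewrite /single negbK => ab; rewrite flow_velE// /vel ab divfK//.
by rewrite subr_eq0 gt_eqF.
Qed.

Lemma block_flow_vel m n : 0 < m < 1 -> block m n -> w t n = w t m.
Proof. by move=> m01 [n01 nm]; rewrite (flow_velE t n01) (flow_velE t m01) nm. Qed.

Let cI (A : set (measurableTypeR R)) : measurable A -> P.-integrable A (EFin \o c).
Proof.
by move=> mA; apply: (integrableS measurableT) (inL2_integrable vel0_inL2).
Qed.

Lemma block_cint m : 0 < m < 1 -> ~~ single p t m ->
  \int[P]_(n in `]alpha t (X t m), beta t (X t m)]) c n =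
  w t m * (beta t (X t m) - alpha t (X t m)).
Proof.
by move=> m01 sm; rewrite -block_vel// potV_incr// alpha_le_beta.
Qed.

Let cstE m k : \int[P]_(n in `]alpha t (X t m), beta t (X t m)]) k =
  k * (beta t (X t m) - alpha t (X t m)).
Proof.
rewrite Rintegral_cst//= unit_prob_itv//=.
- by have := alpha01 p t (X t m); lra.
- exact: alpha_le_beta.
- by have := beta01 p t (X t m); lra.
Qed.

(** On a block, the velocity is the mean of c and k is constant. *)
Lemma block_zero m k : 0 < m < 1 -> ~~ single p t m ->
  (forall n, block m n -> k n = k m) ->
  (\int[P]_(n in block m) ((c n - w t n) * k n)%:E = 0)%E.
Proof.
move=> m01 sm km.
transitivity (\int[P]_(n in block m) (k m * (c n - w t m))%:E)%E.
  apply: eq_integral => n /set_mem bn.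
  by rewrite (km _ bn) (block_flow_vel m01 bn) mulrC.
have i1 : P.-integrable setT (EFin \o (fun n => c n - w t m)).
  exact: (@integrableB _ _ _ P _ measurableT _ _ (cI measurableT) (integrable_cst_unit (w t m) measurableT)).
rewrite (@block_integral m (fun n => k m * (c n - w t m))) //; last first.
  exact: (@integrableZl _ _ _ P _ measurableT _ _ i1).
have i2 : P.-integrable (`]alpha t (X t m), beta t (X t m)]%classic : set R) (EFin \o (fun n => c n - w t m)).
  exact: (integrableS measurableT) i1.
transitivity ((\int[P]_(n in `]alpha t (X t m), beta t (X t m)]) (k m * (c n - w t m)))%:E).
  rewrite fineK//; apply: integrable_fin_num => //.
  exact: (@integrableZl _ _ _ P _ (measurable_itv _) _ _ i2).
rewrite RintegralZl// RintegralB//; last 2 first.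
- exact: cI.
- exact: integrable_cst_unit.
by rewrite block_cint// cstE subrr mulr0.
Qed.

(** Jensen's inequality on one block: c^2 >= 2 w c - w^2, where w is the mean
    of c. *)
Lemma block_sqr m : 0 < m < 1 -> ~~ single p t m ->
  (\int[P]_(n in block m) (w t n ^+ 2)%:E <= \int[P]_(n in block m) (c n ^+ 2)%:E)%E.
Proof.
move=> m01 sm.
have i1 : P.-integrable setT (EFin \o (fun n => c n ^+ 2)).
  exact: inL2_sqr vel0_inL2.
rewrite (@block_integral m (fun n => c n ^+ 2))//.
have -> : (\int[P]_(n in block m) (w t n ^+ 2)%:E = \int[P]_(n in block m) (w t m ^+ 2)%:E)%E.
  by apply: eq_integral => n /set_mem bn; rewrite (block_flow_vel m01 bn).
rewrite (@block_integral m (fun n => w t m ^+ 2))//; last exact: integrable_cst_unit.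
have mI : measurable (`]alpha t (X t m), beta t (X t m)]%classic : set (measurableTypeR R)).
  exact: measurable_itv.
have iE k : P.-integrable (`]alpha t (X t m), beta t (X t m)]%classic : set R) (EFin \o cst k).
  exact: integrable_cst_unit.
rewrite -[leLHS]fineK; last exact: integrable_fin_num (iE _).
have i2 : P.-integrable (`]alpha t (X t m), beta t (X t m)]%classic : set R) (EFin \o (fun n => c n ^+ 2)).
  exact: (integrableS measurableT) i1.
rewrite -[leRHS]fineK; last exact: integrable_fin_num i2.
rewrite lee_fin -/(Rintegral _ _ _) -/(Rintegral _ _ (fun n => c n ^+ 2)) cstE.
have i3 : P.-integrable (`]alpha t (X t m), beta t (X t m)]%classic : set R) (EFin \o (fun n => 2 * w t m * c n)).
  exact: (@integrableZl _ _ _ P _ mI (2 * w t m) _ (cI mI)).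
have i4 := @integrableB _ _ _ P _ mI _ _ i3 (iE (w t m ^+ 2)).
apply: (@le_trans _ _ (\int[P]_(n in `]alpha t (X t m), beta t (X t m)]) (2 * w t m * c n - w t m ^+ 2))).
  rewrite RintegralB//; last exact: iE.
  rewrite RintegralZl//; last exact: cI.
  rewrite block_cint// cstE expr2.
  by rewrite le_eqVlt; apply/orP; left; apply/eqP; ring.
apply: le_Rintegral => // n _.
have := sqr_ge0 (c n - w t m); rewrite !expr2; lra.
Qed.

Definition multi : set (measurableTypeR R) := [set m : R | 0 < m < 1 /\ ~~ single p t m].

Definition level (n : nat) : R := X t (ratr (odflt 0%Q (unpickle n))).

(** The nontrivial blocks, indexed by the rational labels that they contain.  Since
    they have nonempty interior they are all reached, possibly several times;
    hence the passage to seqDU, whose terms are whole blocks or empty. *)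
Definition blocks (n : nat) : set (measurableTypeR R) := multi `&` [set m | X t m = level n].

Lemma blocksE n m : blocks n m -> blocks n = block m.
Proof.
move=> [[m01 sm] mn]; apply/seteqP; split => k /=.
  by move=> [[k01 sk] kn]; split => //; rewrite kn mn.
move=> [k01 km]; split; last by rewrite /= km.
by split => //; rewrite /single km.
Qed.

Lemma measurable_blocks n : measurable (blocks n).
Proof.
have [->//|/set0P[m /blocksE ->]] := eqVneq (blocks n) set0.
exact: measurable_block.
Qed.

Lemma bigcup_blocks : \bigcup_n blocks n = multi.
Proof.
apply/seteqP; split => m; first by move=> [n _ []].
move=> [m01 sm]; move: (sm); rewrite /single negbK => /rat_in_itvoo[r].
rewrite in_itv/= => /andP[r1 r2].
have a01 := alpha01 p t (X t m); have b01 := beta01 p t (X t m).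
have r01 : 0 < (ratr r : R) < 1 by lra.
exists (pickle r) => //; split => //=; rewrite /level pickleK/=.
apply/eqP; rewrite eq_le; apply/andP; split; last by apply/betaP => //; lra.
by rewrite leNgt; apply/negP => h; have := alpha_ge r01 h; lra.
Qed.

Lemma seqDU_blocks n : seqDU blocks n = set0 \/ seqDU blocks n = blocks n.
Proof.
have [[i /= [ni E]]|h] := pselect (exists i : nat, (i < n)%N /\ level i = level n).
  left; rewrite -subset0 => m [[mm ml]] hn; apply: hn.
  rewrite -bigcup_mkord; exists i => //; split => //=.
  by rewrite E.
right; apply/seteqP; split => m; first by move=> [].
move=> mb; split => //; rewrite -bigcup_mkord => -[i /= ni [_ /= mi]].
by apply: h; exists i; split => //; rewrite -mi; have [_ ->] := mb.
Qed.

Lemma measurable_multi : measurable multi.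
Proof. by rewrite -bigcup_blocks; apply: bigcupT_measurable; exact: measurable_blocks. Qed.

Lemma measurable_seqDU_blocks n : measurable (seqDU blocks n).
Proof. by have [->|->] := seqDU_blocks n => //; exact: measurable_blocks. Qed.

Lemma ae_single_flow_vel : {ae P, forall m, ~ multi m -> w t m = c m}.
Proof.
have := @ae_continuous_nd R (quantile rho0) (@quantile_nd R rho0).
apply: (@filterS _ _ (ae_filter_ringOfSetsType P)) => m [m01 qm] hm.
rewrite flow_velE// single_vel//; apply: contrapT => /negP sm; exact: hm.
Qed.

(** The nontrivial blocks are countably many, and block_sqr applies to each.
    Elsewhere the particles are free and keep the velocity c. *)
Lemma flow_vel_inL2 : inL2 (w t) /\ (\int[P]_m (w t m ^+ 2)%:E <= \int[P]_m (c m ^+ 2)%:E)%E.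
Proof.
have mw2 : measurable_fun setT (fun m => (w t m ^+ 2)%:E).
  by apply/measurable_EFinP; apply: measurable_funX; exact: measurable_flow_vel.
have mc2 : measurable_fun setT (fun m => (c m ^+ 2)%:E).
  by apply/measurable_EFinP; apply: measurable_funX; exact: vel0_inL2.1.
have mm := measurable_multi.
have hle : (\int[P]_m (w t m ^+ 2)%:E <= \int[P]_m (c m ^+ 2)%:E)%E.
  have split_ (f : R -> R) : measurable_fun setT (fun m => (f m ^+ 2)%:E) ->
     (\int[P]_m (f m ^+ 2)%:E = \int[P]_(m in multi) (f m ^+ 2)%:E +
        \int[P]_(m in ~` multi) (f m ^+ 2)%:E)%E.
    move=> mf; rewrite -ge0_integral_setU ?setUv//.
    - exact: measurableC.
    - by move=> x _; rewrite lee_fin sqr_ge0.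
    - by apply/disj_setPCl.
  rewrite (split_ _ mw2) (split_ _ mc2); apply: leeD.
    rewrite -bigcup_blocks seqDU_bigcup_eq.
    rewrite !ge0_integral_bigcup; last 8 first.
    - exact: measurable_seqDU_blocks.
    - exact: measurable_funTS.
    - by move=> x _; rewrite lee_fin sqr_ge0.
    - exact: trivIset_seqDU.
    - exact: measurable_seqDU_blocks.
    - exact: measurable_funTS.
    - by move=> x _; rewrite lee_fin sqr_ge0.
    - exact: trivIset_seqDU.
    apply: lee_nneseries => [n *|n _].
      by apply: integral_ge0 => x _; rewrite lee_fin sqr_ge0.
    have [->|->] := seqDU_blocks n; first by rewrite !integral_set0.
    have [->|/set0P[m mb]] := eqVneq (blocks n) set0; first by rewrite !integral_set0.
    rewrite (blocksE mb); have [[m01 sm] _] := mb; exact: block_sqr.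
  apply: ae_ge0_le_integral.
  - exact: measurableC.
  - by move=> x _; rewrite lee_fin sqr_ge0.
  - exact: measurable_funTS.
  - by move=> x _; rewrite lee_fin sqr_ge0.
  - exact: measurable_funTS.
  - have := ae_single_flow_vel; apply: (@filterS _ _ (ae_filter_ringOfSetsType P)) => m hm nm.
    by rewrite hm.
split => //; split; first exact: measurable_flow_vel.
by apply: le_lt_trans hle _; exact: vel0_inL2.2.
Qed.

(** The velocity at time t is the conditional expectation of the initial velocity
    given the position at time t: the difference integrates to 0 over each of the
    countably many nontrivial blocks (block_zero) and vanishes elsewhere. *)
Lemma conditional_expectation k : inL2 k ->
  (forall m n, 0 < m < 1 -> 0 < n < 1 -> X t m = X t n -> k m = k n) ->
  (\int[P]_m (c m * k m)%:E = \int[P]_m (w t m * k m)%:E)%E.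
Proof.
move=> k2 kX.
have i1 := inL2_mul vel0_inL2 k2; have i2 := inL2_mul flow_vel_inL2.1 k2.
have i3 := @integrableB _ _ _ P _ measurableT _ _ i1 i2.
have mm := measurable_multi.
have i4 : P.-integrable setT (EFin \o (fun m => (c m - w t m) * k m)).
  by apply: eq_integrable i3 => // m _; rewrite /= mulrBl EFinB.
suff : (\int[P]_m ((c m - w t m) * k m)%:E = 0)%E.
  move=> h0; have := @integralB_EFin _ _ _ P _ _ _ measurableT i1 i2.
  have -> : (\int[P]_m ((c m * k m)%:E - (w t m * k m)%:E) = 0)%E.
    by rewrite -[RHS]h0; apply: eq_integral => m _; rewrite mulrBl EFinB.
  have := integrable_fin_num measurableT i1; have := integrable_fin_num measurableT i2.
  move=> /fineK <- /fineK <-; rewrite -EFinB => -[] /esym/subr0_eq /= h.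
  by congr EFin.
rewrite -(setUv multi) integral_setU//; last 3 first.
- exact: measurableC.
- by rewrite setUv; exact: (measurable_int _ i4).
- by apply/disj_setPCl.
rewrite [X in (_ + X)%E](_ : _ = 0%E); last first.
  rewrite -[RHS](integral0 P (~` multi)); apply: ae_eq_integral => //.
  - exact: measurableC.
  - by apply: measurable_funTS; exact: (measurable_int _ i4).
  - have := ae_single_flow_vel; apply: (@filterS _ _ (ae_filter_ringOfSetsType P)) => m hm nm.
    by rewrite hm// subrr mul0r.
rewrite adde0 -bigcup_blocks seqDU_bigcup_eq integral_bigcup; last 3 first.
- exact: trivIset_seqDU.
- exact: measurable_seqDU_blocks.
- apply: (integrableS measurableT) i4 => //.
  by apply: bigcupT_measurable; exact: measurable_seqDU_blocks.
apply: eseries0 => n _ _.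
have [->|->] := seqDU_blocks n; first by rewrite integral_set0.
have [->|/set0P[m mb]] := eqVneq (blocks n) set0; first by rewrite integral_set0.
rewrite (blocksE mb); have [[m01 sm] _] := mb; apply: block_zero => //.
by move=> l [l01 lm]; exact: kX.
Qed.

End Blocks.

(** * Test functions *)

Section Plane.
Variable R : realType.
Local Notation plane := (measurableTypeR R * measurableTypeR R)%type.

Lemma continuous_near_box (f : R * R -> R) (z : R * R) (e : R) :
  continuous f -> 0 < e -> exists2 d : R, 0 < d &
  forall y : R * R, `|y.1 - z.1| < d -> `|y.2 - z.2| < d -> `|f y - f z| < e.
Proof.
move=> cf e0; have /cvgrPdist_lt/(_ e e0) := cf z.
rewrite -nbhs_nearE => /nbhs_ballP[d /= d0 hd]; exists d => // y y1 y2.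
rewrite distrC; apply: hd; split; rewrite /ball/= distrC//.
Qed.

(** An open set of the plane is a countable union of rational boxes. *)
Lemma continuous_plane_measurable (f : R * R -> R) : continuous f ->
  measurable_fun setT (f : plane -> measurableTypeR R).
Proof.
move=> cf.
apply: (measurability (@RGenOInfty.G R)) => [|/= _ [_] [r] -> <-].
  exact: RGenOInfty.measurableE.
rewrite setTI.
pose box (a b e : rat) : set plane :=
  (`](ratr a - ratr e), (ratr a + ratr e)[%classic : set R) `*`
  (`](ratr b - ratr e), (ratr b + ratr e)[%classic : set R).
have -> : f @^-1` `]r, +oo[ = \bigcup_(a : rat) \bigcup_(b : rat) \bigcup_(e : rat)
   (if pselect (box a b e `<=` f @^-1` `]r, +oo[) then box a b e else set0).
  apply/seteqP; split => z /=.
    rewrite in_itv/= andbT => rf.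
    have e0 : 0 < f z - r by lra.
    have [d d0 hd] := continuous_near_box z cf e0.
    have d2 : 0 < d / 2 by lra.
    move: (d2) => /rat_in_itvoo[e]; rewrite in_itv/= => /andP[e1 e2].
    have : z.1 - ratr e < z.1 + ratr e by lra.
    move=> /rat_in_itvoo[a]; rewrite in_itv/= => /andP[a1 a2].
    have : z.2 - ratr e < z.2 + ratr e by lra.
    move=> /rat_in_itvoo[b]; rewrite in_itv/= => /andP[b1 b2].
    exists a => //; exists b => //; exists e => //.
    case: pselect => [h|h]; first by split => /=; rewrite in_itv/=; lra.
    exfalso; apply: h => y [/=]; rewrite !in_itv/= andbT => y1 y2.
    have : `|f y - f z| < f z - r by apply: hd; rewrite ltr_norml; lra.
    by rewrite ltr_norml; lra.
  move=> [a _ [b _ [e _]]]; case: pselect => // h /h /=.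
  by rewrite in_itv/=.
apply: bigcupT_measurable_rat => a; apply: bigcupT_measurable_rat => b.
apply: bigcupT_measurable_rat => e; case: pselect => [h|h]; last exact: measurable0.
exact: measurableX.
Qed.

End Plane.

Section TestFunction.
Variables (R : realType) (psi : R * R -> R).
Hypothesis tpsi : test_function psi.
Local Notation px := (partial_x psi).
Local Notation pt := (partial_t psi).

Lemma psi_cont : continuous psi. Proof. exact: (tpsi.1 0%N). Qed.
Lemma px_cont : continuous px. Proof. by case: (tpsi.1 1%N). Qed.
Lemma pt_cont : continuous pt. Proof. by case: (tpsi.1 1%N). Qed.

Lemma psi0_cont : continuous (fun x : R => psi (x, 0)).
Proof.
move=> x; apply: continuous_comp; last exact: psi_cont.
exact: (cvg_pair (@cvg_id _ _) (cvg_cst _)).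
Qed.

Lemma is_derive_x (x t : R) : is_derive (x : R^o) 1 (fun x : R => psi (x, t)) (px (x, t)).
Proof.
rewrite /partial_x derive1E /=; apply: derivableP.
by case: (tpsi.1 1%N) => _ + _ _ _ => /(_ (x, t)).
Qed.

Lemma is_derive_t (x t : R) : is_derive (t : R^o) 1 (fun t : R => psi (x, t)) (pt (x, t)).
Proof.
rewrite /partial_t derive1E /=; apply: derivableP.
by case: (tpsi.1 1%N) => _ _ + _ _ => /(_ (x, t)).
Qed.

Lemma MVTx (a b t : R) : exists2 c : R, Num.min a b <= c <= Num.max a b &
  psi (b, t) - psi (a, t) = px (c, t) * (b - a).
Proof.
have main a' b' : a' <= b' -> exists2 c : R, a' <= c <= b' &
    psi (b', t) - psi (a', t) = px (c, t) * (b' - a').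
  move=> ab; have [||c cab E] := @MVT_segment R (fun x => psi (x, t)) (fun x => px (x, t)) a' b' ab.
  - by move=> x _; exact: is_derive_x.
  - by apply: derivable_within_continuous => x _; case: (is_derive_x x t).
  - by exists c.
have [ab|ba] := leP a b; first exact: main.
have [c cab E] := main _ _ (ltW ba); exists c => //.
by rewrite -opprB E; ring.
Qed.

Lemma MVTt (x a b : R) : a < b -> exists2 c : R, a < c < b &
  psi (x, b) - psi (x, a) = pt (x, c) * (b - a).
Proof.
move=> ab; have [||c cab E] := @MVT R (fun t => psi (x, t)) (fun t => pt (x, t)) a b ab.
- by move=> t _; exact: is_derive_t.
- by apply: derivable_within_continuous => t _; case: (is_derive_t x t).
- by exists c.
Qed.

Local Notation K := (closure [set p : R * R | 0 <= p.2 /\ psi p != 0]).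

Lemma outside_zero z : ~ K z -> exists2 d : R, 0 < d &
  forall y : R * R, `|y.1 - z.1| < d -> `|y.2 - z.2| < d -> 0 <= y.2 -> psi y = 0.
Proof.
move=> nK; apply: contrapT => h; apply: nK => B /nbhs_ballP[d /= d0 dB].
apply: contrapT => hB; apply: h; exists d => // y y1 y2 y0.
apply/eqP; apply: contrapT => /negP py; apply: hB; exists y; split => //.
by apply: dB; split; rewrite /ball/= distrC.
Qed.

Lemma compact_image_bounded (f : R * R -> R) : continuous f ->
  exists2 C : R, 0 <= C & forall z, K z -> `|f z| <= C.
Proof.
move=> cf; have cK : compact (f @` K).
  by apply: continuous_compact tpsi.2; exact: continuous_subspaceT.
have [M [_ hM]] := @compact_bounded _ R^o _ cK.
exists (`|M| + 1); first by have := normr_ge0 M; lra.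
move=> z Kz; apply: hM; last by exists z.
by have := ler_norm M; lra.
Qed.

Lemma psi0_bounded : exists C : R, forall x : R, `|psi (x, 0)| <= C.
Proof.
have [C C0 h] := compact_image_bounded psi_cont; exists C => x.
have [Kz|nK] := pselect (K (x, 0)).
  exact: h.
have [d d0 hd] := outside_zero nK.
by rewrite (hd (x, 0)) ?normr0//= subrr normr0.
Qed.

Lemma px_outside z : 0 <= z.2 -> ~ K z -> px z = 0.
Proof.
move=> z0 /outside_zero[d d0 hd].
rewrite /partial_x derive1E.
have -> : 'D_1 (fun x => psi (x, z.2)) z.1 = 'D_1 (fun _ : R => (0 : R)) z.1.
  apply: near_eq_derive.
  near=> x; apply: hd => //=; last by rewrite subrr normr0.
by rewrite derive_cst.
Unshelve. all: by end_near.
Qed.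

Lemma pt_outside z : 0 < z.2 -> ~ K z -> pt z = 0.
Proof.
move=> z0 /outside_zero[d d0 hd].
rewrite /partial_t derive1E.
have -> : 'D_1 (fun t => psi (z.1, t)) z.2 = 'D_1 (fun _ : R => (0 : R)) z.2.
  apply: near_eq_derive.
  near=> t; apply: hd => //=; first by rewrite subrr normr0.
  by apply: ltW; near: t; apply/nbhs_ballP; exists z.2 => //= t'; rewrite /ball/= ltr_norml; lra.
by rewrite derive_cst.
Unshelve. all: by end_near.
Qed.

(** The half-plane t >= 0 is split into the compact support and its complement,
    where psi and its derivatives vanish.  The bound on the time derivative is
    limited to t > 0: at t = 0 it would involve values of psi for negative
    times. *)
Lemma test_bounds : exists C T : R, [/\ 0 <= C, 0 <= T,
  forall z, 0 <= z.2 -> `|px z| <= C, forall z, 0 < z.2 -> `|pt z| <= C &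
  forall z, T <= z.2 -> [/\ psi z = 0, px z = 0 & pt z = 0] ].
Proof.
have [C1 C10 h1] := compact_image_bounded px_cont.
have [C2 C20 h2] := compact_image_bounded pt_cont.
have cs : continuous (snd : R * R -> R) by move=> z; exact: cvg_snd.
have [T T0 hT] := compact_image_bounded cs.
exists (C1 + C2), (T + 1); split; [lra|lra| | |].
- move=> z z0; have [Kz|nK] := pselect (K z); first by have := h1 _ Kz; lra.
  by rewrite px_outside// normr0; lra.
- move=> z z0; have [Kz|nK] := pselect (K z); first by have := h2 _ Kz; lra.
  by rewrite pt_outside// normr0; lra.
- move=> z zT; have nK : ~ K z.
    by move=> /hT; rewrite ler_norml; lra.
  split; [|by apply: px_outside => //; lra|by apply: pt_outside => //; lra].
  have [d d0 hd] := outside_zero nK.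
  by apply: hd; rewrite ?subrr ?normr0//; lra.
Qed.

End TestFunction.

(** * Test functions along trajectories *)

Section Along.
Variables (R : realType) (p : flow_data R) (psi : R * R -> R).
Hypothesis mq : measurable_fun setT (initpos p).
Hypothesis tpsi : test_function psi.
Local Notation X := (position p).
Local Notation Y := (flow p).
Local Notation px := (partial_x psi).
Local Notation pt := (partial_t psi).
Local Notation mu := (@lebesgue_measure R).
Local Notation plane := (measurableTypeR R * measurableTypeR R)%type.

(** The derivative in time of psi along the trajectory of the particle m. *)
Definition rate (m t : R) : R :=
  pt (Y t m, t) + vel p t (Y t m) * px (Y t m, t).

Lemma measurable_flow_pair :
  measurable_fun setT (fun z : plane => (Y z.2 z.1, z.2) : plane).
Proof. by apply: measurable_fun_pair => //; exact: measurable_flow. Qed.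

Lemma measurable_rate : measurable_fun setT (fun z : plane => rate z.1 z.2 : measurableTypeR R).
Proof.
have mY := measurable_flow_pair.
apply: measurable_funD.
  by apply: (measurableT_comp (continuous_plane_measurable (pt_cont tpsi))).
apply: measurable_funM.
  exact: (measurableT_comp (measurable_vel mq) mY).
by apply: (measurableT_comp (continuous_plane_measurable (px_cont tpsi))).
Qed.

(** psi along a trajectory, continued to negative times by its value at 0, so as
    to be Lipschitz on the whole line. *)
Definition along (m t : R) : R := psi (X (Num.max 0 t) m, Num.max 0 t).

Lemma alongE m t : 0 <= t -> along m t = psi (X t m, t).
Proof. by move=> t0; rewrite /along max_r. Qed.

Lemma along_lipschitz m : 0 < m < 1 -> exists K : R, forall s t,
  `|along m t - along m s| <= K * `|t - s|.
Proof.
move=> m01; have [L L0 hL] := position_lip p m01.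
have [C [T [C0 T0 hx ht _]]] := test_bounds tpsi.
exists (C * L + C).
have main s t : 0 <= s -> s < t -> `|psi (X t m, t) - psi (X s m, s)| <= (C * L + C) * (t - s).
  move=> s0 st.
  have [a _ ha] := MVTx tpsi (X s m) (X t m) t.
  have [b bst hb] := MVTt tpsi (X s m) st.
  have -> : psi (X t m, t) - psi (X s m, s) =
      px (a, t) * (X t m - X s m) + pt (X s m, b) * (t - s).
    by rewrite -ha -hb; ring.
  apply: (le_trans (ler_normD _ _)); rewrite mulrDl; apply: lerD.
    rewrite normrM -mulrA; apply: ler_pM => //; first by apply: hx => /=; lra.
    by have := hL s t; rewrite (gtr0_norm (_ : 0 < t - s)) ?subr_gt0.
  rewrite normrM (gtr0_norm (_ : 0 < t - s)) ?subr_gt0//.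
  by rewrite ler_wpM2r ?subr_ge0 ?(ltW st)//; apply: ht => /=; lra.
have K0 : 0 <= C * L + C by rewrite addr_ge0// mulr_ge0.
have mx (s t : R) : `|Num.max 0 t - Num.max 0 s| <= `|t - s|.
  case: (leP 0 t) => ?; case: (leP 0 s) => ?;
  rewrite ler_norml; have := ler_norm (t - s); have := ler_norm (s - t);
  rewrite (distrC s t); lra.
move=> s t; rewrite /along; apply: (@le_trans _ _ ((C * L + C) * `|Num.max 0 t - Num.max 0 s|)); last first.
  by rewrite ler_wpM2l.
have s0 : 0 <= Num.max 0 s by rewrite le_max lexx.
have t0 : 0 <= Num.max 0 t by rewrite le_max lexx.
move: (Num.max 0 s) (Num.max 0 t) s0 t0 => {}s {}t s0 t0.
have [st|ts|->] := ltgtP s t.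
- by rewrite [X in _ * X]gtr0_norm ?subr_gt0//; exact: main.
- by rewrite distrC [in leRHS]distrC [X in _ * X]gtr0_norm ?subr_gt0//; exact: main.
- by rewrite !subrr !normr0 mulr0.
Qed.

(** Chain rule for a trajectory which has only a right derivative: mean value
    theorem in x and in t separately, and continuity of the partial
    derivatives. *)
Lemma along_deriv m t : 0 < m < 1 -> {for m, continuous (initpos p)} -> 0 < t ->
  resolved p t m ->
  (fun n => n.+1%:R * (along m (t + n.+1%:R^-1) - along m t)) @ \oo --> rate m t.
Proof.
move=> m01 qm t0 rt; rewrite /rate /flow m01.
set A := X t m; set v := vel p t A.
have [L L0 hL] := position_lip p m01.
apply/cvgrPdist_lt => e e0.
pose N := L + `|px (A, t)| + 2.
have N0 : 0 < N by rewrite /N; have := normr_ge0 (px (A, t)); lra.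
have e1 : 0 < e / N by exact: divr_gt0.
have eN : e / N * (L + `|px (A, t)| + 1) < e.
  by rewrite mulrAC ltr_pdivrMr// ltr_pM2l// /N; lra.
have [d1 d10 h1] := continuous_near_box (A, t) (px_cont tpsi) e1.
have [d2 d20 h2] := continuous_near_box (A, t) (pt_cont tpsi) e1.
have [d3 d30 h3] := position_right_deriv t0 m01 qm rt e1.
have L1 : 0 < L + 1 by lra.
pose d := Num.min (Num.min d1 d2) (Num.min d3 (d1 / (L + 1))).
have d0 : 0 < d by rewrite !lt_min d10 d20 d30 divr_gt0.
have dd1 : d <= d1 by rewrite !ge_min lexx.
have dd2 : d <= d2 by rewrite !ge_min lexx orbT.
have dd3 : d <= d3 by rewrite !ge_min lexx orbT.
have dd4 : d <= d1 / (L + 1) by rewrite !ge_min lexx !orbT.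
suff key h : 0 < h -> h < d ->
    `|pt (A, t) + v * px (A, t) - h^-1 * (along m (t + h) - along m t)| < e.
  near=> n.
  have hd : (n.+1%:R^-1 : R) < d by near: n; exact: (near_infty_natSinv_lt (PosNum d0)).
  have h0 : 0 < (n.+1%:R^-1 : R) by rewrite invr_gt0.
  by have := key _ h0 hd; rewrite invrK.
move=> h0 hd.
rewrite !alongE; [|lra|lra].
set s := t + h.
have st : s - t = h by rewrite /s; ring.
have ts : t < s by rewrite /s; lra.
have [a aA ha] := MVTx tpsi A (X s m) s.
have [b bst hb] := MVTt tpsi A ts.
pose sg := h^-1 * (X s m - A).
have -> : h^-1 * (psi (X s m, s) - psi (X t m, t)) = px (a, s) * sg + pt (A, b).
  have -> : psi (X s m, s) - psi (X t m, t) = px (a, s) * (X s m - A) + pt (A, b) * h.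
    by move: hb; rewrite st => hb; rewrite -ha -hb -/A; ring.
  by rewrite /sg; field; lra.
have LX : `|X s m - A| <= L * h by have := hL t s; rewrite st (gtr0_norm h0).
have sgL : `|sg| <= L by rewrite /sg normrM normfV (gtr0_norm h0) mulrC ler_pdivrMr.
have sgv : `|sg - v| <= e / N.
  have := h3 s; rewrite st => /(_ ltac:(lra)).
  rewrite -/A -/v => hv.
  have -> : sg - v = h^-1 * (X s m - A - v * h) by rewrite /sg; field; lra.
  by rewrite normrM normfV (gtr0_norm h0) mulrC ler_pdivrMr.
have aA' : `|a - A| <= L * h.
  by move: aA LX; case: (leP A (X s m)) => ? ?; rewrite !ler_norml; lra.
have Lhd : L * h < d1.
  have : (L + 1) * h < d1 by rewrite mulrC -ltr_pdivlMr//; lra.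
  lra.
have p1 : `|px (a, s) - px (A, t)| < e / N.
  by apply: h1 => /=; [lra|rewrite st gtr0_norm//; lra].
have p2 : `|pt (A, b) - pt (A, t)| < e / N.
  by apply: h2 => /=; [rewrite subrr normr0|rewrite ltr_norml; lra].
have -> : pt (A, t) + v * px (A, t) - (px (a, s) * sg + pt (A, b)) =
  - ((px (a, s) - px (A, t)) * sg + px (A, t) * (sg - v) + (pt (A, b) - pt (A, t))) by ring.
rewrite normrN.
have q1 : `|(px (a, s) - px (A, t)) * sg| <= e / N * L.
  by rewrite normrM; apply: ler_pM; rewrite ?normr_ge0 ?(ltW p1).
have q2 : `|px (A, t) * (sg - v)| <= e / N * `|px (A, t)|.
  by rewrite normrM mulrC ler_wpM2r.
apply: (le_lt_trans (ler_normD _ _)).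
have := ler_normD ((px (a, s) - px (A, t)) * sg) (px (A, t) * (sg - v)).
lra.
Unshelve. all: by end_near.
Qed.

Lemma ae_resolved m : 0 < m < 1 -> {ae mu, forall t : R, 0 < t -> resolved p t m}.
Proof.
move=> m01.
have [[s [s0 sr]]|h] := pselect (exists s : R, 0 < s /\ ~ resolved p s m).
  exists [set s]; split => //; first exact: lebesgue_measure_set1.
  move=> t /= /not_implyP[t0 tr]; exact/esym/(unresolved_eq s0 t0 m01 sr tr).
exists set0; split => //; move=> t /= /not_implyP[t0 tr]; apply: h; by exists t.
Qed.

Lemma along_integral m : 0 < m < 1 -> {for m, continuous (initpos p)} ->
  mu.-integrable `]0%R, +oo[ (EFin \o rate m) /\
  (\int[mu]_(t in `]0%R, +oo[) (rate m t)%:E = (- psi (initpos p m, 0))%:E)%E.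
Proof.
move=> m01 qm.
have [K hK] := along_lipschitz m01.
have [C [T [C0 T0 _ _ hT]]] := test_bounds tpsi.
rewrite -(position_init m01 qm) -alongE//.
apply: (@lipschitz_right_ftc R (along m) (rate m) K T) => //.
- move=> t Tt; rewrite alongE; last lra.
  by have [] := hT (X t m, t) Tt.
- apply: measurable_funTS.
  exact: (measurable_fun_pair2 m measurable_rate).
- have := ae_resolved m01; apply: (@filterS _ _ (ae_filter_ringOfSetsType mu)) => t ht t0.
  by apply: along_deriv => //; exact: ht.
Qed.

End Along.

(** * The solution, its energy and its entropy condition *)

Section Solution.
Variables (R : realType) (rho0 : probability (measurableTypeR R) R) (v0 : R -> R).
Hypothesis v0_cont : continuous v0.
Hypothesis v0_L2 : (\int[rho0]_x (v0 x ^+ 2)%:E < +oo)%E.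
Local Notation P := (@unit_prob R).
Local Notation mu := (@lebesgue_measure R).
Local Notation p := (sticky_data v0_cont v0_L2).
Local Notation c := (vel0 rho0 v0).
Local Notation X := (position p).
Local Notation Y := (flow p).
Local Notation w := (flow_vel v0_cont v0_L2).
Local Notation vel0_inL2 := (vel0_inL2 v0_cont v0_L2).
Local Notation plane := (measurableTypeR R * measurableTypeR R)%type.

Definition flow_rv (t : R) : measurableTypeR R -> measurableTypeR R := Y t.

HB.instance Definition _ t := @isMeasurableFun.Build _ _
  (measurableTypeR R) (measurableTypeR R) (flow_rv t) (measurable_flow_t v0_cont v0_L2 t).

Definition sol_rho (t : R) : probability (measurableTypeR R) R :=
  distribution P (flow_rv t).

Definition sol_v (z : plane) : measurableTypeR R := vel p z.2 z.1.

Lemma measurable_sol_v : measurable_fun setT sol_v.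
Proof. by apply: measurable_vel; exact: measurable_quantile. Qed.

Lemma integral_rho t (f : measurableTypeR R -> \bar R) : measurable_fun setT f ->
  P.-integrable setT (f \o Y t) ->
  (\int[sol_rho t]_x f x = \int[P]_m f (Y t m))%E.
Proof. by move=> mf fi; rewrite integral_distribution. Qed.

Lemma ge0_integral_rho t (f : measurableTypeR R -> \bar R) : measurable_fun setT f ->
  (forall x, 0 <= f x)%E ->
  (\int[sol_rho t]_x f x = \int[P]_m f (Y t m))%E.
Proof. by move=> mf f0; rewrite ge0_integral_distribution. Qed.

(** Each trajectory is continuous, and the test function is bounded. *)
Lemma sol_narrow : narrowly_continuous sol_rho.
Proof.
move=> t t0 g cg bg.
have mg : measurable_fun setT (g : measurableTypeR R -> measurableTypeR R).
  exact: continuous_measurable_fun.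
have [M [_ hM]] := bg.
have gM x : `|g x| <= `|M| + 1 by apply: hM => //; have := ler_norm M; lra.
have mgY s : measurable_fun setT (fun m => g (Y s m)).
  by apply: (measurableT_comp mg); exact: measurable_flow_t.
have igY s : P.-integrable setT (EFin \o (fun m => g (Y s m))).
  apply: le_integrable (integrable_cst_unit (`|M| + 1) measurableT) => //.
    by apply/measurable_EFinP; exact: mgY.
  by move=> m _ /=; rewrite lee_fin [leRHS]ger0_norm ?gM//; have := normr_ge0 M; lra.
have E s : \int[sol_rho s]_x g x = \int[P]_m g (Y s m).
  rewrite /Rintegral (@integral_rho s (EFin \o g))//; first exact/measurable_EFinP.
  exact: igY.
rewrite E; under eq_fun do rewrite E.
apply: (@continuity_under_integral _ _ _ P (fun s m => g (Y s m)) setT measurableT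
   (t - 1) (t + 1) _ _ (fun=> `|M| + 1)).
- by move=> s _; exact: igY.
- apply: aeW => m _ s _; rewrite /flow.
  have [m01|m01] := boolP (0 < m < 1); last exact: cvg_cst.
  apply: continuous_comp; last exact: cg.
  have [K _ hK] := position_lip p m01; exact: (lipschitz_cts hK).
- exact: integrable_cst_unit.
- by move=> s _; apply: aeW => m _; exact: gM.
- by rewrite inE/= in_itv/=; lra.
Qed.

(** The velocity itself is constant on the blocks, so it can be the weight k of
    conditional_expectation. *)
Lemma flow_vel_sqr t : 0 < t -> (\int[P]_m (w t m ^+ 2)%:E = \int[P]_m (c m * w t m)%:E)%E.
Proof.
move=> t0; have w2 := (flow_vel_inL2 v0_cont v0_L2 t0).1.
rewrite (conditional_expectation t0 w2); first by apply: eq_integral => m _; rewrite expr2.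
by move=> m n m01 n01 E; rewrite (flow_velE _ _ t m01) (flow_velE _ _ t n01) E.
Qed.

(** By stickiness the velocity at time t is constant on the blocks of the
    earlier time s, which gives int v_t^2 = int c v_t = int v_s v_t. *)
Lemma flow_vel_energy s t : 0 < s -> s <= t ->
  (\int[P]_m (w t m ^+ 2)%:E <= \int[P]_m (w s m ^+ 2)%:E)%E.
Proof.
move=> s0 st; have t0 : 0 < t by lra.
have wt2 := (flow_vel_inL2 v0_cont v0_L2 t0).1; have ws2 := (flow_vel_inL2 v0_cont v0_L2 s0).1.
have E : (\int[P]_m (w t m ^+ 2)%:E = \int[P]_m (w s m * w t m)%:E)%E.
  rewrite (flow_vel_sqr t0); apply: (conditional_expectation s0 wt2) => m n m01 n01 E.
  rewrite (flow_velE _ _ t m01) (flow_velE _ _ t n01).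
  by rewrite (position_merge s0 st m01 n01 E).
have i1 := inL2_sqr wt2; have i2 := inL2_sqr ws2; have i3 := inL2_mul ws2 wt2.
have f1 := integrable_fin_num measurableT i1.
have f2 := integrable_fin_num measurableT i2.
rewrite -(fineK f1) -(fineK f2) lee_fin.
change (\int[P]_m (w t m ^+ 2) <= \int[P]_m (w s m ^+ 2)).
have ER : \int[P]_m (w t m ^+ 2) = \int[P]_m (w s m * w t m).
  by rewrite /Rintegral E.
have : \int[P]_m (w s m * w t m) <= \int[P]_m (2^-1 * (w s m ^+ 2 + w t m ^+ 2)).
  have i4 := @integrableD _ _ _ P _ measurableT _ _ i2 i1.
  apply: le_Rintegral => //.
  - exact: (@integrableZl _ _ _ P _ measurableT _ _ i4).
  - move=> m _; have := sqr_ge0 (w s m - w t m); rewrite !expr2; lra.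
rewrite RintegralZl//; last exact: (@integrableD _ _ _ P _ measurableT _ _ i2 i1).
rewrite RintegralD// -ER.
lra.
Qed.

Lemma kineticE t : kinetic_energy sol_rho sol_v t = (2^-1%:E * \int[P]_m (w t m ^+ 2)%:E)%E.
Proof.
have mw : measurable_fun setT (fun x : measurableTypeR R => sol_v (x, t)).
  exact: (measurable_fun_pair1 t measurable_sol_v).
rewrite /kinetic_energy ge0_integral_rho.
- rewrite -ge0_integralZl//.
  + by apply/measurable_EFinP; apply: measurable_funX; exact: measurable_flow_vel.
  + by move=> m _; rewrite lee_fin sqr_ge0.
- apply/measurable_EFinP; apply: measurable_funM => //; exact: measurable_funX.
- by move=> x; rewrite lee_fin mulr_ge0 ?sqr_ge0.
Qed.

Lemma sol_energy s t : 0 < s -> s <= t ->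
  (kinetic_energy sol_rho sol_v t <= kinetic_energy sol_rho sol_v s)%E /\
  (kinetic_energy sol_rho sol_v s < +oo)%E.
Proof.
move=> s0 st; rewrite !kineticE; split.
  by apply: lee_wpmul2l; [rewrite lee_fin|exact: flow_vel_energy].
apply: lte_mul_pinfty; rewrite ?lee_fin//.
exact: (flow_vel_inL2 v0_cont v0_L2 s0).1.2.
Qed.

(** vel_entropy applies at x if some particle is not on the right of x and some
    particle is not on the left of x; this holds wherever a particle sits, hence
    almost everywhere. *)
Lemma sol_entropy t : 0 < t -> exists A : set (measurableTypeR R),
  [/\ measurable A, sol_rho t A = 1%E &
      forall x y : R, A x -> A y ->
        (sol_v (x, t) - sol_v (y, t)) * (x - y) <= t^-1 * (x - y) ^+ 2].
Proof.
move=> t0.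
have mb := measurable_fun_pair1 t (measurable_beta p).
have ma := measurable_fun_pair1 t (measurable_alpha p).
pose A : set (measurableTypeR R) := [set x : R | 0 < beta p t x] `&` [set x : R | alpha p t x < 1].
have mA : measurable A.
  apply: measurableI.
    have h : measurable_fun setT (fun x : measurableTypeR R => 0 < beta p t x).
      by apply: measurable_fun_ltr.
    by have := h measurableT [set true] I; rewrite setTI.
  have h : measurable_fun setT (fun x : measurableTypeR R => alpha p t x < 1).
    by apply: measurable_fun_ltr.
  by have := h measurableT [set true] I; rewrite setTI.
exists A; split => //; last first.
  by move=> x y [bx ax] [by_ ay]; exact: vel_entropy.
apply/eqP; rewrite eq_le probability_le1//= -unit_prob_unit.
apply: le_measure; rewrite ?inE//.
- by rewrite -[X in measurable X]setTI; apply: (measurable_flow_t v0_cont v0_L2 t).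
- move=> m /=; rewrite in_itv/= => m01; rewrite /flow_rv /flow m01 /A /=.
  by have := beta_ge p t m01; have := alpha_le p t m01; split; lra.
Qed.

(** * The weak formulation *)

Section Weak.
Variable psi : R * R -> R.
Hypothesis tpsi : test_function psi.
Local Notation px := (partial_x psi).
Local Notation pt := (partial_t psi).
Local Notation rate := (rate p psi).

Let mq : measurable_fun setT (initpos p) := measurable_quantile rho0.

Lemma measurable_rate_t t : measurable_fun setT (fun m => rate m t).
Proof. exact: (measurable_fun_pair1 t (measurable_rate mq tpsi)). Qed.

Definition sqnorm (f : R -> R) : R := \int[P]_m (f m ^+ 2).

Lemma sqnorm_ge0 (f : R -> R) : 0 <= sqnorm f.
Proof. by apply: Rintegral_ge0 => x _; exact: sqr_ge0. Qed.

Lemma rate_bound : exists C T : R, [/\ 0 <= C, 0 <= T,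
  forall m t, 0 < t -> `|rate m t| <= C * (1 + `|w t m|) &
  forall m t, T <= t -> rate m t = 0].
Proof.
have [C [T [C0 T0 hx ht hT]]] := test_bounds tpsi; exists C, T; split => //.
- move=> m t t0; apply: le_trans (ler_normD _ _) _; rewrite mulrDr mulr1.
  apply: lerD; first by apply: ht.
  by rewrite normrM mulrC ler_wpM2r//; apply: hx => /=; lra.
- by move=> m t Tt; have [_ h1 h2] := hT (Y t m, t) Tt; rewrite /rate h1 h2 mulr0 addr0.
Qed.

Lemma rate_inL2 t : 0 < t -> inL2 (fun m => rate m t).
Proof.
move=> t0; have [C [T [C0 T0 hC _]]] := rate_bound.
split; first exact: measurable_rate_t.
have w2 := (flow_vel_inL2 v0_cont v0_L2 t0).1.
have i1 := @integrableD _ _ _ P _ measurableT _ _ (integrable_cst_unit 1 measurableT) (inL2_sqr w2).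
have i2 := @integrableZl _ _ _ P _ measurableT (2 * C ^+ 2) _ i1.
apply: (@le_lt_trans _ _ (\int[P]_m (2 * C ^+ 2 * (1 + w t m ^+ 2))%:E)%E); last first.
  by have := integrable_fin_num measurableT i2; rewrite fin_numElt => /andP[].
apply: ge0_le_integral => //.
- by move=> m _; rewrite lee_fin sqr_ge0.
- by apply/measurable_EFinP; apply: measurable_funX; exact: measurable_rate_t.
- exact: (measurable_int _ i2).
- move=> m _; rewrite lee_fin.
  have h := hC m t t0; have r0 := normr_ge0 (rate m t).
  have h2 : rate m t ^+ 2 <= (C * (1 + `|w t m|)) ^+ 2.
    by rewrite -[rate m t ^+ 2]real_normK ?num_real// lerXn2r// ?nnegrE// mulr_ge0// addr_ge0.
  apply: (le_trans h2); rewrite exprMn -[leRHS]mulrA [leRHS]mulrCA ler_wpM2l ?sqr_ge0//.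
  have := sqr_ge0 (`|w t m| - 1); have := real_normK (num_real (w t m)).
  by rewrite !expr2; lra.
Qed.

(** The integrand is a product of two L2 functions, whose norms are bounded
    uniformly in time, and it vanishes for large times. *)
Lemma rate_integral_bound : exists C T : R, [/\ 0 <= C, 0 <= T,
  forall f t, 0 < t -> inL2 f ->
   (\int[P]_m `|(f m * rate m t)%:E| <= (C * (1 + 2 * sqnorm f + 2 * sqnorm c))%:E)%E &
  forall f t, T <= t -> (\int[P]_m `|(f m * rate m t)%:E| = 0)%E].
Proof.
have [C [T [C0 T0 hC hT]]] := rate_bound; exists C, T; split => //; last first.
  by move=> f t Tt; rewrite integral0_eq// => m _; rewrite (hT _ _ Tt) mulr0/= normr0.
move=> f t t0 f2; have [w2 wc] := flow_vel_inL2 v0_cont v0_L2 t0.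
have j1 := inL2_sqr f2; have j2 := inL2_sqr w2; have j3 := inL2_sqr vel0_inL2.
have k1 : P.-integrable setT (EFin \o (fun m => 2 * f m ^+ 2)).
  exact: (@integrableZl _ _ _ P _ measurableT 2 _ j1).
have k2 : P.-integrable setT (EFin \o (fun m => 2 * w t m ^+ 2)).
  exact: (@integrableZl _ _ _ P _ measurableT 2 _ j2).
have k3 : P.-integrable setT (EFin \o (fun m => 1 + 2 * f m ^+ 2)).
  exact: (@integrableD _ _ _ P _ measurableT _ _ (integrable_cst_unit 1 measurableT) k1).
have k4 : P.-integrable setT (EFin \o (fun m => 1 + 2 * f m ^+ 2 + 2 * w t m ^+ 2)).
  exact: (@integrableD _ _ _ P _ measurableT _ _ k3 k2).
have k5 : P.-integrable setT (EFin \o (fun m => C * (1 + 2 * f m ^+ 2 + 2 * w t m ^+ 2))).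
  exact: (@integrableZl _ _ _ P _ measurableT C _ k4).
apply: (@le_trans _ _ (\int[P]_m (C * (1 + 2 * f m ^+ 2 + 2 * w t m ^+ 2))%:E)%E).
  apply: ge0_le_integral => //.
  - apply: measurableT_comp => //; apply/measurable_EFinP.
    by apply: measurable_funM; [exact: f2.1|exact: measurable_rate_t].
  - exact: (measurable_int _ k5).
  - move=> m _; rewrite lee_fin normrM.
    apply: (@le_trans _ _ (`|f m| * (C * (1 + `|w t m|)))).
      by rewrite ler_wpM2l// hC.
    rewrite mulrCA ler_wpM2l//.
    have := sqr_ge0 (`|w t m| - `|f m|); have := sqr_ge0 (`|f m| - 1).
    have := sqr_ge0 (w t m); have := sqr_ge0 (f m).
    have := real_normK (num_real (w t m)); have := real_normK (num_real (f m)).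
    by rewrite !expr2; lra.
have -> : (\int[P]_m (C * (1 + 2 * f m ^+ 2 + 2 * w t m ^+ 2))%:E)%E =
    (\int[P]_m (C * (1 + 2 * f m ^+ 2 + 2 * w t m ^+ 2)))%:E.
  by rewrite /Rintegral fineK//; exact: (integrable_fin_num measurableT k5).
rewrite lee_fin (RintegralZl C measurableT k4) ler_wpM2l//.
rewrite (RintegralD measurableT k3 k2) (RintegralD measurableT (integrable_cst_unit 1 measurableT) k1).
rewrite (RintegralZl 2 measurableT j1) (RintegralZl 2 measurableT j2).
have c1 : \int[P]_x (cst 1 x : R) = 1 by rewrite Rintegral_cst//= probability_setT mulr1.
have sw : sqnorm (w t) <= sqnorm c.
  by apply: fine_le => //; [exact: (integrable_fin_num measurableT j2)|exact: (integrable_fin_num measurableT j3)].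
move: c1 sw; rewrite /sqnorm /= => -> sw; lra.
Qed.

Lemma psi0_inL2 : inL2 (fun m => psi (quantile rho0 m, 0)).
Proof.
have [C hC] := psi0_bounded tpsi.
have mp : measurable_fun setT (fun m => psi (quantile rho0 m, 0)).
  apply: (@measurableT_comp _ _ _ _ _ _ (fun x : R => psi (x, 0))); last exact: measurable_quantile.
  exact: (continuous_measurable_fun (psi0_cont tpsi)).
split => //; apply: (@le_lt_trans _ _ (\int[P]_m (C ^+ 2)%:E)%E); last first.
  by have := integrable_fin_num measurableT (integrable_cst_unit (C ^+ 2) measurableT); rewrite fin_numElt => /andP[].
apply: ge0_le_integral => //.
- by move=> m _; rewrite lee_fin sqr_ge0.
- by apply/measurable_EFinP; exact: measurable_funX.
- move=> m _; rewrite lee_fin -[psi _ ^+ 2]real_normK ?num_real//.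
  by rewrite lerXn2r// ?nnegrE// (le_trans _ (hC 0)).
Qed.

(** Fubini: for fixed m the integral over time is known from along_integral. *)
Lemma weak_weighted k : inL2 k ->
  (\int[mu]_(t in `]0%R, +oo[) \int[P]_m (k m * rate m t)%:E =
   - \int[P]_m (k m * psi (quantile rho0 m, 0))%:E)%E.
Proof.
move=> k2.
have [C [T [C0 T0 hC hT]]] := rate_integral_bound.
pose D : set plane := setT `*` (`]0%R, +oo[%classic : set R).
have mD : measurable D by exact: measurableX.
pose g (z : plane) : R := k z.1 * rate z.1 z.2.
pose f : plane -> \bar R := (EFin \o g) \_ D.
have mg : measurable_fun setT g.
  apply: measurable_funM; last exact: (measurable_rate mq tpsi).
  by apply: (measurableT_comp k2.1).
have mf : measurable_fun setT f.
  apply: (iffLR (measurable_restrictT _ mD)).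
  have h : measurable_fun setT (EFin \o g) by exact/measurable_EFinP.
  exact: measurable_funTS h.
have fE1 m t : f (m, t) = ((fun t => (k m * rate m t)%:E) \_ (`]0%R, +oo[%classic : set R)) t.
  rewrite /f !patchE; congr (if _ then _ else _).
  by apply/idP/idP; rewrite !inE /D/= => //; case.
have fE2 t : (fun m => f (m, t)) = (if t \in (`]0%R, +oo[%classic : set R) then (fun m => (k m * rate m t)%:E) else cst 0%E).
  by apply/funext => m; rewrite fE1 patchE; case: ifPn.
pose M := C * (1 + 2 * sqnorm k + 2 * sqnorm c).
have fi : (P \x mu)%E.-integrable setT f.
  apply/integrable21ltyP => //.
  have M0 : 0 <= M by rewrite /M mulr_ge0// !addr_ge0// mulr_ge0// sqnorm_ge0.
  have E t : (\int[P]_m `|f (m, t)|)%E =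
      ((fun t => \int[P]_m `|(k m * rate m t)%:E|)%E \_ (`]0%R, +oo[%classic : set R)) t.
    rewrite patchE; under eq_integral do rewrite fE1 patchE.
    by case: ifPn => // _; rewrite integral0_eq// => m _; rewrite abse0.
  under eq_integral do rewrite E.
  rewrite -integral_mkcond; apply: (@time_integral_finite R M T) => //.
  - apply/(measurable_restrictT _ _).2 => //; rewrite -(funext E).
    apply: (@measurable_fun_fubini_tonelli_G _ _ _ _ R P (abse \o f)).
      exact: measurableT_comp.
    by move=> z; exact: abse_ge0.
  - by move=> t /=; apply: integral_ge0 => m _.
  - by move=> t t0; exact: hC.
  - by move=> t Tt; apply: hT; exact: ltW.
have := Fubini fi.
rewrite (_ : (\int[mu]_y \int[P]_x f (x, y) = \int[mu]_(t in `]0%R, +oo[) \int[P]_m (k m * rate m t)%:E)%E); last first.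
  rewrite [RHS]integral_mkcond; apply: eq_integral => t _.
  rewrite patchE fE2; case: ifPn => // _.
  by rewrite integral0.
move=> <-.
have iP := inL2_mul k2 psi0_inL2.
transitivity (\int[P]_m (- (k m * psi (quantile rho0 m, 0)))%:E)%E; last first.
  rewrite -integralN//; exact: integrable_add_def.
apply: ae_eq_integral => //.
- exact: (measurable_fubini_F fi).
- by apply/measurable_EFinP; apply: measurableT_comp => //; apply/measurable_EFinP; exact: (measurable_int _ iP).
have := @ae_continuous_nd R (quantile rho0) (@quantile_nd R rho0).
apply: (@filterS _ _ (ae_filter_ringOfSetsType P)) => m [m01 qm] _.
have [i1 E] := along_integral mq tpsi m01 qm.
rewrite /= (eq_integral _ _ (fun t _ => fE1 m t)) -integral_mkcond.
under eq_integral do rewrite EFinM.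
rewrite integralZl// E -EFinM mulrN//.
Qed.

(** The weight f is 1 for the mass and the velocity for the momentum: in both
    cases the flux pulled back to the mass coordinate is f times the rate of
    change of psi along the flow. *)
Lemma spacetime_along_flow (h : plane -> R) (f : R -> R -> R) (S : R) :
  measurable_fun setT h ->
  (forall t m, h (Y t m, t) = f t m * rate m t) ->
  (forall t, 0 < t -> inL2 (f t) /\ sqnorm (f t) <= S) ->
  spacetime_integrable sol_rho h /\
  spacetime_integral sol_rho h =
    (\int[mu]_(t in `]0%R, +oo[) \int[P]_m (f t m * rate m t)%:E)%E.
Proof.
move=> mh hE hf.
have [C [T [C0 T0 hC hT]]] := rate_integral_bound.
have mht t : measurable_fun setT (fun x : measurableTypeR R => h (x, t)).
  exact: (measurable_fun_pair1 t mh).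
have mhY : measurable_fun setT (fun z : plane => h (Y z.2 z.1, z.2)).
  exact: (measurableT_comp mh (measurable_flow_pair p)).
have absE t : (\int[sol_rho t]_x `|h (x, t)|%:E = \int[P]_m `|(f t m * rate m t)%:E|)%E.
  rewrite ge0_integral_rho//; first by apply: eq_integral => m _; rewrite hE.
  by apply/measurable_EFinP; apply: measurableT_comp.
split.
  have S0 : 0 <= S by have [_] := hf 1 ltr01; apply: le_trans; exact: sqnorm_ge0.
  apply: (@time_integral_finite R (C * (1 + 2 * S + 2 * sqnorm c)) T).
  - by rewrite mulr_ge0// !addr_ge0// mulr_ge0// sqnorm_ge0.
  - apply: measurable_funTS; under eq_fun do rewrite absE.
    have mG : measurable_fun setT (fun z : plane => (`|h (Y z.2 z.1, z.2)|%:E)).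
      by apply/measurable_EFinP; apply: measurableT_comp.
    have := @measurable_fun_fubini_tonelli_G _ _ _ _ R P _ mG.
    move=> /(_ (fun z => ltac:(by rewrite lee_fin))).
    by congr (measurable_fun _ _); apply/funext => t; apply: eq_integral => m _ /=; rewrite hE.
  - by move=> t; apply: integral_ge0 => x _; rewrite lee_fin.
  - move=> t t0; have [f2 fS] := hf t t0; rewrite absE; apply: le_trans (hC _ _ t0 f2) _.
    by rewrite lee_fin ler_wpM2l// !lerD// ler_wpM2l.
  - by move=> t Tt; rewrite absE; apply: hT; exact: ltW.
apply: eq_integral => t; rewrite inE/= in_itv/= andbT => t0.
have mE : measurable_fun setT (fun x : measurableTypeR R => (h (x, t))%:E).
  exact/measurable_EFinP.
have iE : P.-integrable setT ((fun x : measurableTypeR R => (h (x, t))%:E) \o Y t).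
  have i := inL2_mul (hf t t0).1 (rate_inL2 t0).
  by apply: eq_integrable i => // m _; rewrite /= hE.
rewrite (integral_rho mE iE); apply: eq_integral => m _.
by rewrite hE.
Qed.

(** Passing from the weight f t, at time t, to the initial weight k turns the
    integral over time into the one computed in weak_weighted, which cancels the
    initial term A. *)
Lemma weak_identity (h : plane -> R) (f : R -> R -> R) (k : R -> R) (A : \bar R) (S : R) :
  measurable_fun setT h ->
  (forall t m, h (Y t m, t) = f t m * rate m t) ->
  (forall t, 0 < t -> inL2 (f t) /\ sqnorm (f t) <= S) -> inL2 k ->
  (forall t, 0 < t ->
     (\int[P]_m (f t m * rate m t)%:E = \int[P]_m (k m * rate m t)%:E)%E) ->
  (A = \int[P]_m (k m * psi (quantile rho0 m, 0))%:E)%E ->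
  spacetime_integrable sol_rho h /\ (spacetime_integral sol_rho h + A = 0)%E.
Proof.
move=> mh hE hf k2 fk ->.
have [i E] := spacetime_along_flow mh hE hf; split; first exact: i.
have fA := integrable_fin_num measurableT (inL2_mul k2 psi0_inL2).
rewrite E (_ : (\int[mu]_(t in _) _ = - \int[P]_m (k m * psi (quantile rho0 m, 0))%:E)%E).
  by rewrite addeC subee.
rewrite -(weak_weighted k2); apply: eq_integral => t; rewrite inE/= in_itv/= andbT.
exact: fk.
Qed.

Let mpx := continuous_plane_measurable (px_cont tpsi).
Let mpt := continuous_plane_measurable (pt_cont tpsi).
Let mv : measurable_fun setT (fun z : plane => sol_v z : R) := measurable_sol_v.

Lemma sol_mass :
  let mass z := pt z + sol_v z * px z in
  spacetime_integrable sol_rho mass /\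
  (spacetime_integral sol_rho mass + \int[rho0]_x (psi (x, 0%R))%:E = 0)%E.
Proof.
move=> mass.
apply: (@weak_identity mass (fun _ _ => 1) (fun=> 1) _ (sqnorm (fun=> 1))) => //.
- by apply: measurable_funD => //; exact: measurable_funM.
- by move=> t m; rewrite mul1r.
- by move=> t _; split => //; exact: inL2_cst.
- exact: inL2_cst.
- under [RHS]eq_integral do rewrite mul1r.
  rewrite (@integral_quantile _ rho0 (fun x => (psi (x, 0))%:E))//.
  + by apply/measurable_EFinP; exact: (continuous_measurable_fun (psi0_cont tpsi)).
  + exact: inL2_integrable psi0_inL2.
Qed.

(** The rate of change of psi depends on the particle through its position only,
    so the velocity at time t may be replaced by the initial velocity. *)
Lemma sol_momentum :
  let momentum z := sol_v z * pt z + sol_v z ^+ 2 * px z in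
  spacetime_integrable sol_rho momentum /\
  (spacetime_integral sol_rho momentum + \int[rho0]_x (psi (x, 0%R) * v0 x)%:E = 0)%E.
Proof.
move=> momentum.
apply: (@weak_identity momentum w c _ (sqnorm c)).
- by apply: measurable_funD => //; apply: measurable_funM => //; exact: measurable_funX.
- by move=> t m; rewrite /momentum /rate /flow_vel /sol_v/=; ring.
- move=> t t0; have [w2 wc] := flow_vel_inL2 v0_cont v0_L2 t0; split => //.
  apply: fine_le => //; [exact: (integrable_fin_num measurableT (inL2_sqr w2))|].
  exact: (integrable_fin_num measurableT (inL2_sqr vel0_inL2)).
- exact: vel0_inL2.
- move=> t t0; apply/esym/(conditional_expectation t0); first exact: rate_inL2.
  by move=> m n m01 n01 E; rewrite /rate /flow m01 n01 E.
- have c2 := vel0_inL2.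
  rewrite (@integral_quantile _ rho0 (fun x => (psi (x, 0) * v0 x)%:E))//.
  + by apply: eq_integral => m _; rewrite mulrC.
  + apply/measurable_EFinP; apply: measurable_funM; last exact: continuous_measurable_fun.
    exact: (continuous_measurable_fun (psi0_cont tpsi)).
  + exact: inL2_mul psi0_inL2 c2.
Qed.

End Weak.

Lemma sol_weak : weak_solution_pair rho0 v0 sol_rho sol_v.
Proof.
split; first exact: sol_narrow.
- by apply: measurable_funTS; exact: measurable_sol_v.
- move=> psi tpsi mass momentum.
  have [i1 e1] := sol_mass tpsi; have [i2 e2] := sol_momentum tpsi.
  by split; [exact: i1|exact: i2|exact: e1|exact: e2].
Qed.

End Solution.

(* In the last clause the null set N may contain 0, so no meaning needs to be
   given to rho and v at time 0. *)
Theorem theorem1p4 (R : realType)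
    (rho0 : probability (measurableTypeR R) R) (v0 : R -> R)
    (v0_cont : continuous v0)
    (v0_L2 : (\int[rho0]_x (v0 x ^+ 2)%:E < +oo)%E) :
  exists (rho : R -> probability (measurableTypeR R) R)
         (v : measurableTypeR R * measurableTypeR R -> R),
    [/\ weak_solution_pair rho0 v0 rho v,
        {ae @lebesgue_measure R, forall t : R, 0 < t ->
          exists A : set (measurableTypeR R),
            [/\ measurable A, rho t A = 1%E &
                forall x y : R, A x -> A y ->
                  (v (x, t) - v (y, t)) * (x - y) <= t^-1 * (x - y) ^+ 2]} &
        exists N : set R,
          [/\ N `<=` `[0, +oo[,
              (@lebesgue_measure R).-negligible N &
              forall s t : R, 0 <= s -> s <= t -> ~ N s -> ~ N t ->
                (kinetic_energy rho v t <= kinetic_energy rho v s)%E /\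
                (kinetic_energy rho v s < +oo)%E]].
Proof.
exists (sol_rho v0_cont v0_L2), (sol_v v0_cont v0_L2); split.
- exact: sol_weak.
- by apply: aeW => t t0; exact: sol_entropy.
- exists [set 0]; split.
  + by move=> t /= ->; rewrite in_itv/= lexx.
  + exists [set 0]; split => //; exact: lebesgue_measure_set1.
  + move=> s t s0 st Ns _; apply: sol_energy => //.
    by rewrite lt_neqAle s0 andbT eq_sym; apply/eqP.
Qed.
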